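(* Under the standing assumptions in the context, let $\bar u\in\mathfrak M(\omega_1)$ be a locally optimal control of problem (P) with associated state $\bar y=S\bar u$, and assume that $J$ is Gâteaux differentiable at $\bar y$. Then there exists an adjoint state $p\in W^{1,q'}_0(\Omega)\hookrightarrow C(\overline\Omega)$ such that $$-\Delta p=J'(\bar y)\ \text{ in }W^{-1,q'}(\Omega),\qquad 0\in p|_{\omega_1}+\alpha\,\partial\mathrm D^c_{u^0}(\bar u).\qquad( * )$$ The second condition in $( * )$ is fulfilled if and only if the pair $\big((-\tfrac1\alpha p|_{\omega_1})^{\overline c},\,-\tfrac1\alpha p|_{\omega_1}\big)$ solves the dual Kantorovich problem $$\max\ \int_{\omega_0}\varphi\,du^0+\int_{\omega_1}\psi\,d\bar u\quad\text{over }\varphi\in C(\omega_0),\ \psi\in C(\omega_1)\ \text{ with }\varphi(x)+\psi(\xi)\le c(x,\xi)\ \ \forall (x,\xi)\in\omega_0\times\omega_1 .$$ If $J$ is additionally convex, then $( * )$ is also sufficient for (global) optimality of $\bar u$.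
   Context: For a compact set $X\subset\mathbb R^n$, $\mathfrak M(X)=C(X)^*$ denotes the finite signed Borel measures on $X$ with the total variation norm. $r'$ denotes the conjugate exponent of $r$. Standing assumptions. $d_0\in\mathbb N$, $d_1\in\{2,3\}$; $\Omega\subset\mathbb R^{d_1}$ is a bounded Lipschitz domain; $\omega_0\subset\mathbb R^{d_0}$ and $\omega_1\subset\overline\Omega$ are nonempty compact sets; $u^0\in\mathfrak M(\omega_0)$, $u^0\ge 0$; $c\in C(\omega_0\times\omega_1)$; $\alpha>0$. $p_\Omega>d_1$ is an exponent (provided by Theorem 0.5(a) of Jerison–Kenig 1995) such that for every $p\in(p_\Omega',p_\Omega)$ and every $f\in W^{-1,p}(\Omega)$ the equation $-\Delta y=f$ has a unique solution $y\in W^{1,p}_0(\Omega)$. The exponent $q$ is fixed with $q'\in(d_1,p_\Omega)$ and, if $d_1=3$, additionally $q'<6$. $J:W^{1,q}_0(\Omega)\to\mathbb R$ is continuous and Gâteaux differentiable. The weak Laplacian $\Delta:W^{1,r}_0(\Omega)\to W^{-1,r}(\Omega)=W_0^{1,r'}(\Omega)^*$ is given by $-\langle\Delta y,v\rangle=\int_\Omega\nabla y\cdot\nabla v\,d\lambda^{d_1}$. $E:W^{1,q'}_0(\Omega)\to C(\omega_1)$ is the Sobolev embedding into $C_0(\Omega)\subset C(\overline\Omega)$ followed by restriction to $\omega_1$; $E^*:\mathfrak M(\omega_1)\to W^{-1,q}(\Omega)$, $\langle E^*u,v\rangle=\int_{\omega_1}v\,du$. $S:=(-\Delta)^{-1}E^*:\mathfrak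 M(\omega_1)\to W^{1,q}_0(\Omega)$. $\mathrm D^c_{u^0}(u):=\inf\{\int c\,d\pi:\pi\in\mathfrak M(\omega_0\times\omega_1),\ \pi\ge0,\ (P_0)_\#\pi=u^0,\ (P_1)_\#\pi=u\}$ with coordinate projections $P_0,P_1$ and $\inf\emptyset=\infty$. Problem (P): minimize $f(u)=J(Su)+\alpha\,\mathrm D^c_{u^0}(u)$ over $u\in\mathfrak M(\omega_1)$. $\bar u$ is locally optimal if $f(\bar u)<\infty$ and $f(\bar u)\le f(u)$ for all $u$ in some norm neighborhood of $\bar u$ in $\mathfrak M(\omega_1)$. $\partial \mathrm D^c_{u^0}(\bar u)\subset C(\omega_1)$ is the convex subdifferential with respect to the pairing of $\mathfrak M(\omega_1)$ with $C(\omega_1)$: $\psi\in\partial \mathrm D^c_{u^0}(\bar u)$ iff $\mathrm D^c_{u^0}(u)\ge\mathrm D^c_{u^0}(\bar u)+\int_{\omega_1}\psi\,d(u-\bar u)$ for all $u\in\mathfrak M(\omega_1)$. (In the sufficiency statement $\bar u\in\mathfrak M(\omega_1)$ with $\mathrm D^c_{u^0}(\bar u)<\infty$, $\bar y=S\bar u$, is assumed to satisfy $( * )$ with some $p$.) The $\overline c$-conjugate of $\zeta\in C(\omega_1)$ is $\zeta^{\overline c}:\omega_0\to\mathbb R$, $\zeta^{\overline c}(x)=\inf_{\xi\in\omega_1}(c(x,\xi)-\zeta(\xi))$. *)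

(* Defs.v *)
From HB Require Import structures.
From mathcomp Require Import all_boot all_order all_algebra.
From mathcomp Require Import all_classical all_reals all_analysis.
From mathcomp Require Import lra.

Set Implicit Arguments.
Unset Strict Implicit.
Unset Printing Implicit Defensive.

Import Order.TTheory GRing.Theory Num.Theory.
Import numFieldNormedType.Exports.

Local Open Scope classical_set_scope.
Local Open Scope ring_scope.

(* R^n is 'rV[R]_n. The library gives it its topology and (sup) norm, but no
   measurable structure: we equip it with the Borel sigma-algebra. *)
Definition rV_display : measure_display. Proof. exact. Qed.

Section Borel_rV.
Context {R : realType} (n : nat).

Let borel0 : <<s @open 'rV[R]_n >> set0.
Proof. exact: sigma_algebra0. Qed.

Let borelC (A : set 'rV[R]_n) :
  <<s @open 'rV[R]_n >> A -> <<s @open 'rV[R]_n >> (~` A).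
Proof. exact: sigma_algebraC. Qed.

Let borel_bigcup (F : (set 'rV[R]_n)^nat) :
  (forall i, <<s @open 'rV[R]_n >> (F i)) ->
  <<s @open 'rV[R]_n >> (\bigcup_i F i).
Proof. exact: sigma_algebra_bigcup. Qed.

HB.instance Definition _ := @isMeasurable.Build rV_display
  'rV[R]_n <<s @open 'rV[R]_n >> borel0 borelC borel_bigcup.

End Borel_rV.

Lemma open_measurable_rV {R : realType} n (U : set 'rV[R]_n) :
  open U -> measurable U.
Proof. by move=> oU; exact: sub_sigma_algebra. Qed.

Section Lebesgue_rV.
Context {R : realType}.

Definition rV_cons n (z : 'rV[R]_n * R) : 'rV[R]_n.+1 :=
  \row_i (if unlift ord0 i is Some j then z.1 ord0 j else z.2).

Lemma measurable_rV_cons n : measurable_fun setT (@rV_cons n).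
Proof.
apply: (@measurability _ _ _ _ setT (@rV_cons n) (@open 'rV[R]_n.+1)) => //.
move=> _ [U oU <-]; rewrite setTI.
pose box (k : 'rV[rat]_n * rat * nat) : set ('rV[R]_n * R) :=
  ball (map_mx ratr k.1.1 : 'rV[R]_n) (k.2.+1%:R^-1 : R) `*`
  ball (ratr k.1.2 : R) (k.2.+1%:R^-1 : R).
have -> : @rV_cons n @^-1` U =
    \bigcup_(k in [set k | box k `<=` @rV_cons n @^-1` U]) box k.
  apply/seteqP; split=> [[t x] Utx|z [k kU kz]]; last exact: kU.
  have /nbhs_ballP[e /= e0 eU] := open_nbhs_nbhs (conj oU Utx).
  have [m _ me] : exists2 m : nat, true & 2 * m.+1%:R^-1 < e :> R.
    have e2 : 0 < e / 2 by rewrite divr_gt0.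
    have [m me] := ltr_add_invr e2.
    exists m => //; rewrite add0r in me.
    by rewrite mulrC -ltr_pdivlMr.
  have m0 : 0 < m.+1%:R^-1 :> R by rewrite invr_gt0.
  have rat_near (d a : R) : 0 < d -> exists r : rat, `|ratr r - a| < d.
    move=> d0; have [|r] := @rat_in_itvoo R (a - d) (a + d); first lra.
    rewrite in_itv/= => /andP[r1 r2]; exists r.
    by rewrite ltr_norml; apply/andP; split; lra.
  have [qx qxP] := rat_near _ x m0.
  have /choice[qt qtP] : forall j, exists r : rat,
      `|ratr r - t ord0 j| < m.+1%:R^-1 by move=> j; exact: rat_near.
  exists (\row_j qt j, qx, m); last first.
    split; rewrite /= ?/ball//=.
    split=> // i j; rewrite !mxE ord1; exact: qtP.
  move=> [t' x'] [] /= [_ tt'] xx'; apply: eU; split=> // i j.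
  rewrite ord1 !mxE.
  have key (d a b c : R) : 2 * d < e -> `|a - b| < d -> `|a - c| < d ->
      `|b - c| < e.
    by rewrite !ltr_norml => de /andP[? ?] /andP[? ?]; apply/andP; split; lra.
  case: unliftP => [k _|_] /=; last exact: key me qxP xx'.
  by apply: key me (qtP k) _; have := tt' ord0 k; rewrite !mxE.
rewrite bigcup_mkcond; apply: countable_bigcupT_measurable => // k.
case: ifPn => // _; apply: measurableX.
- by apply: open_measurable_rV; apply: ball_open; rewrite invr_gt0.
- by apply: measurable_realfun.open_measurable; apply: ball_open; rewrite invr_gt0.
Qed.

Section lebesgue_step.
Variables (n : nat) (m : {measure set 'rV[R]_n -> \bar R}).

Definition lebesgue_step : set 'rV[R]_n.+1 -> \bar R :=
  pushforward (m \x lebesgue_measure)%E (@rV_cons n).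

Let mcons := @measurable_rV_cons n.

Let step0 : lebesgue_step set0 = 0%E. Proof. exact: measure0. Qed.

Let step_ge0 A : (0 <= lebesgue_step A)%E. Proof. exact: measure_ge0. Qed.

Let step_sigma_additive : semi_sigma_additive lebesgue_step.
Proof. exact: measure_semi_sigma_additive. Qed.

HB.instance Definition _ := isMeasure.Build _ _ _ lebesgue_step
  step0 step_ge0 step_sigma_additive.

End lebesgue_step.

(* Lebesgue measure on R^n; on R^0 it is the unit mass. *)
Fixpoint lebesgue_rV n : {measure set 'rV[R]_n -> \bar R} :=
  if n is m.+1 then lebesgue_step (lebesgue_rV m) else \d_(0 : 'rV[R]_0).

End Lebesgue_rV.

Section Lipschitz_domain.
Context {R : realType} {d : nat}.

(* Near every boundary point, after a change of orthonormal coordinates Q, the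
   set is the strict epigraph, in the i-th coordinate, of a Lipschitz function
   of the remaining coordinates (extracted by col'). *)
Definition lipschitz_boundary (Om : set 'rV[R]_d) : Prop :=
  forall x0, (closure Om `\` Om) x0 ->
  exists (Q : 'M[R]_d) (i : 'I_d) (U : set 'rV[R]_d) (gam : 'rV[R]_d.-1 -> R),
    [/\ Q *m Q^T = 1%:M, open_nbhs x0 U, exists k : R, k.-lipschitz gam &
        forall x, U x ->
          (Om x <-> gam (col' i (x *m Q)) < (x *m Q) ord0 i)].

Definition bounded_lipschitz_domain (Om : set 'rV[R]_d) : Prop :=
  [/\ Om !=set0, open Om, connected Om, bounded_set Om &
      lipschitz_boundary Om].

End Lipschitz_domain.

Section Sobolev.
Context {R : realType} {d : nat}.
Variable Om : set 'rV[R]_d.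

Definition conj_exp (r : R) : R := r / (r - 1).

Fixpoint Ck (k : nat) (phi : 'rV[R]_d -> R) : Prop :=
  continuous phi /\
  if k is k'.+1 then
    forall i : 'I_d, (forall x, derivable phi x (delta_mx ord0 i)) /\
                     Ck k' ('D_(delta_mx ord0 i) phi)
  else True.

(* C_c^oo(Om) *)
Definition test_fun (phi : 'rV[R]_d -> R) : Prop :=
  [/\ forall k, Ck k phi, compact (closure [set x | phi x != 0]) &
      closure [set x | phi x != 0] `<=` Om].

(* A Sobolev function is represented by a pair (y, g) of a function and its
   weak gradient. Values outside Om are irrelevant, and pairs at Sobolev
   distance 0, i.e. equal almost everywhere on Om, represent the same element
   of the Sobolev space. In particular a functional which is continuous for
   W1norm is a functional on the space of equivalence classes. *)
Definition sobolev_fun : Type :=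
  (('rV[R]_d -> R) * ('I_d -> 'rV[R]_d -> R))%type.

HB.instance Definition _ := GRing.Lmodule.on sobolev_fun.

Definition in_Lp (r : R) (f : 'rV[R]_d -> R) : Prop :=
  measurable_fun Om f /\ ('N[lebesgue_rV d]_r%:E[EFin \o (f \_ Om)] < +oo)%E.

Definition weak_gradient (y : 'rV[R]_d -> R) (g : 'I_d -> 'rV[R]_d -> R) :=
  forall phi, test_fun phi -> forall i,
    \int[lebesgue_rV d]_(x in Om) (y x * 'D_(delta_mx ord0 i) phi x) =
    - \int[lebesgue_rV d]_(x in Om) (g i x * phi x).

(* W^{1,r}(Om) *)
Definition W1 (r : R) : set sobolev_fun :=
  [set y | [/\ in_Lp r y.1, forall i, in_Lp r (y.2 i) &
               weak_gradient y.1 y.2]].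

(* Any of the usual equivalent norms of W^{1,r}(Om) may be used here. *)
Definition W1norm (r : R) (y : sobolev_fun) : \bar R :=
  ('N[lebesgue_rV d]_r%:E[EFin \o (y.1 \_ Om)] +
   \sum_(i < d) 'N[lebesgue_rV d]_r%:E[EFin \o (y.2 i \_ Om)])%E.

Definition sobolev_of (phi : 'rV[R]_d -> R) : sobolev_fun :=
  (phi, fun i => 'D_(delta_mx ord0 i) phi).

(* W^{1,r}_0(Om): closure of C_c^oo(Om) in W^{1,r}(Om) *)
Definition W10 (r : R) : set sobolev_fun :=
  [set y | W1 r y /\
    forall e : R, 0 < e ->
      exists2 phi, test_fun phi & (W1norm r (y - sobolev_of phi)%R < e%:E)%E].

(* (W^{1,s}_0(Om))^* *)
Definition W10_dual (s : R) : set (sobolev_fun -> R) :=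
  [set F | (forall (a : R) y z, W10 s y -> W10 s z ->
              F (a *: y + z) = a * F y + F z) /\
           exists C : R, forall y, W10 s y ->
             (`|F y|%:E <= C%:E * W1norm s y)%E].

(* W^{-1,r}(Om) = (W^{1,r'}_0(Om))^* *)
Definition Wm1 (r : R) : set (sobolev_fun -> R) := W10_dual (conj_exp r).

(* <- Delta y, v> *)
Definition neg_laplacian (y v : sobolev_fun) : R :=
  \int[lebesgue_rV d]_(x in Om) \sum_(i < d) y.2 i x * v.2 i x.

(* - Delta y = F in W^{-1,r}(Om) *)
Definition poisson (r : R) (F : sobolev_fun -> R) (y : sobolev_fun) : Prop :=
  forall v, W10 (conj_exp r) v -> neg_laplacian y v = F v.

Definition poisson_uniquely_solvable (r : R) : Prop :=
  forall F, Wm1 r F ->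
    (exists2 y, W10 r y & poisson r F y) /\
    (forall y z, W10 r y -> W10 r z -> poisson r F y -> poisson r F z ->
       W1norm r (y - z) = 0%E).

(* Sobolev embedding into C_0(Om): the representative of v which is continuous
   on the closure of Om and vanishes on the boundary. (The default value of
   xget is used for those v that have no such representative.) *)
Definition sobolev_embedding (v : sobolev_fun) : 'rV[R]_d -> R :=
  xget (cst 0) [set g : 'rV[R]_d -> R |
    [/\ {within closure Om, continuous g},
        forall x, (closure Om `\` Om) x -> g x = 0 &
        {ae lebesgue_rV d, forall x, Om x -> g x = v.1 x}]].

Definition continuous_on_W10 (r : R) (J : sobolev_fun -> R) : Prop :=
  forall y, W10 r y -> forall e : R, 0 < e -> exists2 dlt : R, 0 < dlt &
    forall z, W10 r z -> (W1norm r (z - y)%R < dlt%:E)%E -> `|J z - J y| < e.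

Definition is_gateaux_derivative (r : R) (J : sobolev_fun -> R)
    (y : sobolev_fun) (DJy : sobolev_fun -> R) : Prop :=
  W10_dual r DJy /\
  forall h, W10 r h -> (fun t : R => t^-1 * (J (y + t *: h) - J y)) @ 0^' --> DJy h.

Definition convex_on_W10 (r : R) (J : sobolev_fun -> R) : Prop :=
  forall y z (t : R), W10 r y -> W10 r z -> 0 <= t <= 1 ->
    J (t *: y + (1 - t) *: z) <= t * J y + (1 - t) * J z.

End Sobolev.

Section Signed_measures.
Context {disp : measure_display} {T : measurableType disp} {R : realType}.

(* The elements of M(X), X compact in R^n, are represented by the signed Borel
   measures on R^n that are concentrated on X; the nonnegative ones by finite
   measures with the same property. *)
Definition concentrated (X : set T) (mu : set T -> \bar R) : Prop :=
  forall A, measurable A -> A `&` X = set0 -> mu A = 0%E.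

Variable mu : {charge set T -> \bar R}.

Definition hahn_pos : set T := projT1 (cid (Hahn_decomposition mu)).
Definition hahn_neg : set T :=
  projT1 (cid (projT2 (cid (Hahn_decomposition mu)))).
Definition hahnP : hahn_decomposition mu hahn_pos hahn_neg :=
  projT2 (cid (projT2 (cid (Hahn_decomposition mu)))).

Definition charge_integral (X : set T) (f : T -> R) : R :=
  \int[jordan_pos hahnP]_(x in X) f x - \int[jordan_neg hahnP]_(x in X) f x.

Definition total_variation : \bar R := charge_variation hahnP setT.

End Signed_measures.

Section Kantorovich.
Context {R : realType} {d0 d1 : nat}.
Variables (w0 : set 'rV[R]_d0) (w1 : set 'rV[R]_d1).
Variables (u0 : {finite_measure set 'rV[R]_d0 -> \bar R}).
Variable c : 'rV[R]_d0 * 'rV[R]_d1 -> R.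

Definition transport_plan (u : {charge set 'rV[R]_d1 -> \bar R})
    (pi : {finite_measure set ('rV[R]_d0 * 'rV[R]_d1)%type -> \bar R}) : Prop :=
  [/\ concentrated (w0 `*` w1) pi,
      forall A, measurable A -> pushforward pi fst A = u0 A &
      forall B, measurable B -> pushforward pi snd B = u B].

Definition transport_cost (u : {charge set 'rV[R]_d1 -> \bar R}) : \bar R :=
  ereal_inf [set \int[pi]_(z in w0 `*` w1) (c z)%:E |
             pi in transport_plan u]%E.

Definition transport_subdifferential (ubar : {charge set 'rV[R]_d1 -> \bar R})
    (psi : 'rV[R]_d1 -> R) : Prop :=
  {within w1, continuous psi} /\
  forall u : {charge set 'rV[R]_d1 -> \bar R}, concentrated w1 u ->
    (transport_cost ubar + (charge_integral (cadd u (copp ubar)) w1 psi)%:E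
      <= transport_cost u)%E.

Definition c_conjugate (zeta : 'rV[R]_d1 -> R) (x : 'rV[R]_d0) : R :=
  inf [set c (x, xi) - zeta xi | xi in w1].

Definition dual_feasible (phi : 'rV[R]_d0 -> R) (psi : 'rV[R]_d1 -> R) : Prop :=
  [/\ {within w0, continuous phi}, {within w1, continuous psi} &
      forall x xi, w0 x -> w1 xi -> phi x + psi xi <= c (x, xi)].

Definition dual_value (u : {charge set 'rV[R]_d1 -> \bar R})
    (phi : 'rV[R]_d0 -> R) (psi : 'rV[R]_d1 -> R) : R :=
  \int[u0]_(x in w0) phi x + charge_integral u w1 psi.

Definition dual_solution (u : {charge set 'rV[R]_d1 -> \bar R})
    (phi : 'rV[R]_d0 -> R) (psi : 'rV[R]_d1 -> R) : Prop :=
  dual_feasible phi psi /\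
  forall phi' psi', dual_feasible phi' psi' ->
    dual_value u phi' psi' <= dual_value u phi psi.

End Kantorovich.

Section Control_problem.
Context {R : realType} {d0 d1 : nat}.
Variables (Om : set 'rV[R]_d1) (w0 : set 'rV[R]_d0) (w1 : set 'rV[R]_d1).
Variables (u0 : {finite_measure set 'rV[R]_d0 -> \bar R}).
Variable c : 'rV[R]_d0 * 'rV[R]_d1 -> R.
Variables (alpha q : R) (J : @sobolev_fun R d1 -> R).

(* <E^* u, v>; the restriction to w1 is built into the integral over w1 *)
Definition embedding_adjoint (u : {charge set 'rV[R]_d1 -> \bar R})
    (v : @sobolev_fun R d1) : R :=
  charge_integral u w1 (sobolev_embedding Om v).

(* S u *)
Definition control_to_state (u : {charge set 'rV[R]_d1 -> \bar R}) :
    @sobolev_fun R d1 :=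
  xget 0 [set y | W10 Om q y /\ poisson Om q (embedding_adjoint u) y].

Definition objective (u : {charge set 'rV[R]_d1 -> \bar R}) : \bar R :=
  ((J (control_to_state u))%:E + alpha%:E * transport_cost w0 w1 u0 c u)%E.

Definition locally_optimal (ubar : {charge set 'rV[R]_d1 -> \bar R}) : Prop :=
  [/\ concentrated w1 ubar, (objective ubar < +oo)%E &
      exists2 e : R, 0 < e &
        forall u : {charge set 'rV[R]_d1 -> \bar R}, concentrated w1 u ->
          (total_variation (cadd u (copp ubar)) < e%:E)%E ->
          (objective ubar <= objective u)%E].

Definition globally_optimal (ubar : {charge set 'rV[R]_d1 -> \bar R}) : Prop :=
  [/\ concentrated w1 ubar, (objective ubar < +oo)%E &
      forall u : {charge set 'rV[R]_d1 -> \bar R}, concentrated w1 u ->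
        (objective ubar <= objective u)%E].

(* 0 \in p|_w1 + alpha * (subdifferential of the transport cost at ubar) *)
Definition transport_optimality (ubar : {charge set 'rV[R]_d1 -> \bar R})
    (p : @sobolev_fun R d1) : Prop :=
  exists2 psi, transport_subdifferential w0 w1 u0 c ubar psi &
    forall xi, w1 xi -> 0 = sobolev_embedding Om p xi + alpha * psi xi.

End Control_problem.

(* Main.v *)
(** The state equation is well posed because, for s = q' > d, Morrey's inequality
    embeds W^{1,s}_0 into C_0: for a test function [phi] and a point x, integrate the
    derivative of [phi] along the segments t |-> x + t (w, 1), average over the
    directions w in a cube and apply Young's inequality with the weight t^(n/s).
    Hence E^* u belongs to W^{-1,q}, and testing the adjoint equation with
    S u - S ubar gives DJ(ybar)(S u - S ubar) = int p d(u - ubar).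

    The transport cost D is convex along segments, while J o S is differentiable
    along them, so local optimality of [ubar] gives
    DJ(ybar)(S u - S ubar) + alpha (D u - D ubar) >= 0 for all u, that is,
    - p / alpha belongs to the subdifferential of D at [ubar]. Conversely this
    inequality and the convexity of J give global optimality.

    If psi is a subgradient of D at [ubar], comparing [ubar] with the images of u0 under
    measurable almost-minimizers x |-> xi of c(x, xi) - psi(xi) shows that D ubar is at
    most the dual value of (psi^c, psi); weak duality then makes this pair a dual
    solution. For the converse implication one subgradient is already known from local
    optimality, so that strong Kantorovich duality is not needed. *)
Require Import Defs.
From HB Require Import structures.
From mathcomp Require Import all_boot all_order all_algebra.
From mathcomp Require Import all_classical all_reals all_analysis.
From mathcomp Require Import measurable_realfun ring lra.

Set Implicit Arguments.
Unset Strict Implicit.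
Unset Printing Implicit Defensive.

Import Order.TTheory GRing.Theory Num.Theory.
Import numFieldNormedType.Exports.

Local Open Scope classical_set_scope.
Local Open Scope ring_scope.

(** * Lebesgue measure on R^n *)

Section borel_rV.
Context {R : realType}.

(** Choices hidden in the definitions shape the proof. Sobolev functions are pairs rather than
    classes, and [control_to_state] and [sobolev_embedding] select by [xget]: S is affine only up to
    Sobolev distance 0, and the embedding is linear only on [closure Om]. Hence S u occurs only
    tested against functions of W^{1,q'}_0, under J, whose continuity identifies representatives, or
    under the derivative of J. The Hahn decomposition behind [charge_integral] is chosen as well, so
    integrals are computed from arbitrary decompositions of a charge into finite measures.

    A norm neighbourhood is enough for the first-order inequality because the total variation
    distance from ubar to ubar + t (u - ubar) is O(t). The transport cost may be infinite and its
    infimum need not be attained, so convexity is applied to individual plans, whose costs are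
    finite, and the infimum over plans is taken last. *)

Lemma within_continuous_preimage (T U : topologicalType) (D : set T)
    (f : T -> U) (B : set U) :
  {within D, continuous f} -> open B ->
  exists2 V, open V & D `&` f @^-1` B = D `&` V.
Proof.
move=> /continuousP cf oB; have /open_subspaceP[V oV VD] := cf _ oB.
by exists V => //; rewrite [LHS]setIC -VD setIC.
Qed.

Lemma within_continuous_measurable_rV n (D : set 'rV[R]_n) (f : 'rV[R]_n -> R) :
  measurable D -> {within D, continuous f} -> measurable_fun D f.
Proof.
move=> mD cf; apply: (measurability _ (measurable_realfun.RGenOpens.measurableE R)).
move=> _ [_ [a [b ->] <-]].
have [V oV ->] := within_continuous_preimage cf (@interval_open _ (BRight a) (BLeft b) isT isT).
by apply: measurableI => //; exact: open_measurable_rV.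
Qed.

Lemma continuous_measurable_rV n (f : 'rV[R]_n -> R) :
  continuous f -> measurable_fun setT f.
Proof.
by move=> cf; apply: within_continuous_measurable_rV => //; exact: continuous_subspaceT.
Qed.

Lemma continuous_measurable_rV_rV n m (f : 'rV[R]_n -> 'rV[R]_m) :
  continuous f -> measurable_fun setT f.
Proof.
move=> cf; apply: (@measurability _ _ _ _ setT f (@open 'rV[R]_m)) => //.
move=> _ [U oU <-]; rewrite setTI; apply: open_measurable_rV.
exact: open_comp.
Qed.

(** The scaled image measure gives every half-open interval its length, and this determines Lebesgue
    measure. *)
Lemma lebesgue_affine (a t : R) (A : set R) : 0 < t -> measurable A ->
  (t%:E * lebesgue_measure ((fun x => a + t * x)%R @^-1` A) =
   lebesgue_measure A)%E.
Proof.
move=> t0 mA.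
have mf : measurable_fun [set: measurableTypeR R]
    ((fun x => a + t * x) : measurableTypeR R -> measurableTypeR R).
  by apply: measurable_funD => //; exact: measurable_funM.
pose m : {measure set (measurableTypeR R) -> \bar R} :=
  mscale (NngNum (ltW t0)) (measure_function_pushforward__canonical__measure_function_Measure lebesgue_measure mf).
rewrite [RHS](_ : _ = m A)//.
apply: lebesgue_measure_unique => // _ [[x y]] _ <-.
rewrite /m/= /mscale/= /pushforward.
rewrite [X in lebesgue_measure X = _](_ : _ = `]x, y]%classic)//.
have -> : (fun z => a + t * z) @^-1` `]x, y]%classic =
   `](x - a) / t, (y - a) / t]%classic.
  apply/seteqP; split => z/=; rewrite !in_itv/= ltr_pdivrMr// ler_pdivlMr//.
    by move=> /andP[? ?]; apply/andP; split; lra.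
  by move=> /andP[? ?]; apply/andP; split; lra.
rewrite !lebesgue_measure_itv/= !lte_fin ltr_pM2r ?invr_gt0// ltrD2r.
case: ifPn => _; last by rewrite mule0.
by rewrite -EFinM -!EFinB; congr EFin; field; rewrite gt_eqF.
Qed.

Lemma ge0_integral_affine (a t : R) (f : R -> \bar R) : 0 < t ->
  measurable_fun setT f -> (forall x, 0 <= f x)%E ->
  (t%:E * \int[lebesgue_measure]_x f (a + t * x)%R =
   \int[lebesgue_measure]_x f x)%E.
Proof.
move=> t0 mf f0.
have mg : measurable_fun [set: measurableTypeR R]
    ((fun x => a + t * x) : measurableTypeR R -> measurableTypeR R).
  by apply: measurable_funD => //; exact: measurable_funM.
pose P : {measure set (measurableTypeR R) -> \bar R} :=
  measure_function_pushforward__canonical__measure_function_Measure lebesgue_measure mg.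
have -> : (\int[lebesgue_measure]_x f (a + t * x)%R = \int[P]_x f x)%E.
  by rewrite ge0_integral_pushforward// preimage_setT.
rewrite -(@ge0_integral_mscale _ _ R P _ measurableT (NngNum (ltW t0)))//.
by apply: eq_measure_integral => A mA _; exact: lebesgue_affine.
Qed.

Definition rV_uncons n (x : 'rV[R]_n.+1) : 'rV[R]_n * R :=
  (\row_j x ord0 (lift ord0 j), x ord0 ord0).

Lemma rV_unconsK n : cancel (@rV_uncons n) (@rV_cons R n).
Proof.
move=> x; apply/rowP => i; rewrite mxE; case: unliftP => [j|] -> //=.
by rewrite mxE.
Qed.

(** Balls of the sup norm are cubes, and [rV_cons] pulls a cube back to a product of a cube of one
    dimension less and an interval. In dimension 0 the value is the unit mass. *)
Lemma lebesgue_rV_ball n (x : 'rV[R]_n) (e : R) : 0 < e ->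
  lebesgue_rV n (ball x e) = ((2 * e) ^+ n)%:E.
Proof.
move=> e0; elim: n => [|n IH] in x *.
  rewrite /= diracE expr0 mem_set//.
  by rewrite -[ball _ _ _]/(ball x e _) (_ : 0 = x) ?thinmx0//; exact: ballxx.
rewrite [LHS]/= /lebesgue_step /pushforward.
have -> : @rV_cons R n @^-1` ball x e =
    ball (rV_uncons x).1 e `*` ball (rV_uncons x).2 e.
  apply/seteqP; split => [[z t] [_ xz]|[z t] [[_ /= xz] xt]] /=.
    split; last by have := xz ord0 ord0; rewrite mxE unlift_none.
    split => // i j; rewrite !mxE.
    by have := xz ord0 (lift ord0 j); rewrite mxE liftK !ord1.
  split => // i j; rewrite ord1 mxE.
  case: unliftP => [k|] -> //=.
  by have := xz ord0 k; rewrite mxE.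
rewrite product_measure1E//; last 2 first.
- by apply: open_measurable_rV; exact: ball_open.
- by apply: measurable_realfun.open_measurable; exact: ball_open.
rewrite IH [X in (_ * X)%E](_ : _ = (e *+ 2)%:E); last first.
  exact: (lebesgue_measure_ball _ (ltW e0)).
by rewrite -EFinM mulr_natl -exprSr.
Qed.

Lemma sigma_finite_lebesgue_rV n : sigma_finite setT (@lebesgue_rV R n).
Proof.
exists (fun k => ball (0 : 'rV[R]_n) k.+1%:R).
  apply/seteqP; split => // x _; exists (Num.truncn `|x|) => //.
  rewrite -ball_normE /ball_/= sub0r normrN.
  by rewrite truncnS_gt.
move=> k; split; first by apply: open_measurable_rV; exact: ball_open.
by rewrite lebesgue_rV_ball// ltry.
Qed.

(* [lebesgue_rV n] is a [Measure.type] rather than a function, so that instances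
   cannot be attached to it directly. *)
Definition leb n : set 'rV[R]_n -> \bar R := lebesgue_rV n.
Arguments leb n : clear implicits.

HB.instance Definition _ n := Measure.copy (leb n) (lebesgue_rV n).
HB.instance Definition _ n := Measure_isSigmaFinite.Build _ _ _ (leb n)
  (sigma_finite_lebesgue_rV n).

Lemma ge0_integral_rV_cons n (f : 'rV[R]_n.+1 -> \bar R) :
  measurable_fun setT f -> (forall x, 0 <= f x)%E ->
  (\int[lebesgue_rV n.+1]_x f x =
   \int[lebesgue_measure]_t \int[lebesgue_rV n]_z f (rV_cons (z, t)))%E.
Proof.
move=> mf f0.
rewrite /= /lebesgue_step ge0_integral_pushforward//; last exact: measurable_rV_cons.
rewrite preimage_setT.
have mc : measurable_fun setT (f \o @rV_cons R n).
  by apply: measurableT_comp => //; exact: measurable_rV_cons.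
have E1 := @fubini_tonelli1 _ _ _ _ R (leb n) (@lebesgue_measure R) _ mc (fun _ => f0 _).
have E2 := @fubini_tonelli _ _ _ _ R (leb n) (@lebesgue_measure R) _ mc (fun _ => f0 _).
exact: (etrans E1 E2).
Qed.

Lemma measurable_rV_affine n (a : 'rV[R]_n) (t : R) :
  measurable_fun setT (fun x : 'rV[R]_n => a + t *: x).
Proof.
apply: continuous_measurable_rV_rV => x.
apply: (@continuousD _ _ _ (cst a) (fun y => t *: y)); first exact: cst_continuous.
exact: scaler_continuous.
Qed.

Lemma measurable_rV_cons_section n (f : 'rV[R]_n.+1 -> \bar R) s :
  measurable_fun setT f -> measurable_fun setT (fun z => f (@rV_cons R n (z, s))).
Proof.
move=> mf; apply: measurableT_comp => //.
by apply: measurableT_comp; [exact: measurable_rV_cons|exact: measurable_pair2].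
Qed.

Lemma measurable_integral_rV_cons n (f : 'rV[R]_n.+1 -> \bar R) :
  measurable_fun setT f -> (forall x, 0 <= f x)%E ->
  measurable_fun setT (fun s => \int[lebesgue_rV n]_z f (rV_cons (z, s)))%E.
Proof.
move=> mf f0.
have mc : measurable_fun setT (f \o @rV_cons R n).
  by apply: measurableT_comp => //; exact: measurable_rV_cons.
exact: (@measurable_fun_fubini_tonelli_G _ _ _ _ R (leb n) _ mc (fun _ => f0 _)).
Qed.

(** Each coordinate contributes one factor t. The change of variables for cones reduces to this
    lemma, since the cone map is a dilation on every slice of fixed t. *)
Lemma ge0_integral_rV_affine n (a : 'rV[R]_n) (t : R) (f : 'rV[R]_n -> \bar R) :
  0 < t -> measurable_fun setT f -> (forall x, 0 <= f x)%E ->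
  ((t ^+ n)%:E * \int[lebesgue_rV n]_x f (a + t *: x)%R =
   \int[lebesgue_rV n]_x f x)%E.
Proof.
move=> t0; elim: n => [|n IH] in a f *; move=> mf f0.
  by rewrite expr0 mul1e; apply: eq_integral => x _; rewrite !thinmx0.
have tn0 : 0 <= t ^+ n by rewrite exprn_ge0 // ltW.
have mfa : measurable_fun setT (fun x : 'rV[R]_n.+1 => f (a + t *: x)).
  by apply: measurableT_comp => //; exact: measurable_rV_affine.
rewrite (ge0_integral_rV_cons mf f0) (ge0_integral_rV_cons mfa)//.
rewrite -[RHS](ge0_integral_affine (a ord0 ord0) t0 (measurable_integral_rV_cons mf f0)); last first.
  by move=> s; exact: integral_ge0.
rewrite exprS EFinM -muleA; congr (_ * _)%E.
have gm := measurable_integral_rV_cons mfa (fun x => f0 _).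
rewrite -(ge0_integralZl lebesgue_measure measurableT gm)//; last first.
  by move=> s _; exact: integral_ge0.
apply: eq_integral => s _.
rewrite -[RHS](IH (rV_uncons a).1 (fun z => f (rV_cons (z, _))))//; last first.
  exact: measurable_rV_cons_section.
congr (_ * _)%E; apply: eq_integral => z _; congr f.
by apply/rowP => j; rewrite !mxE; case: unliftP => [k|] ->; rewrite /= ?mxE.
Qed.

End borel_rV.
Arguments leb {R} n.

(** * Chain rule for functions with continuous partial derivatives *)

Section chain_rule.
Context {R : realType} {V : normedModType R}.
Implicit Types (f : V -> R) (x y u e : V).

Lemma is_derive_line f x e (s df : R) :
  is_derive (x + s *: e) e f df -> is_derive s 1 (fun t : R => f (x + t *: e)) df.
Proof.
move=> [fe <-].
have E : (fun h : R => h^-1 *: ((fun t : R => f (x + t *: e)) (h *: (1 : R) + s) - f (x + s *: e))) =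
         (fun h : R => h^-1 *: (f (h *: e + (x + s *: e)) - f (x + s *: e))).
  apply/funext => h; congr (_ *: (f _ - _)).
  by rewrite scalerDl [h *: 1]mulr1 addrCA.
split; first by rewrite /derivable /= E.
by rewrite /derive /= E.
Qed.

(** Both signs of s are covered because the lemma is applied to s = h c with h tending to 0 from
    both sides. *)
Lemma mvt_line f x e (s : R) : (forall y, derivable f y e) ->
  exists2 t : R, `|t| <= `|s| & f (x + s *: e) - f x = s * 'D_e f (x + t *: e).
Proof.
move=> fe; pose g (t : R) := f (x + t *: e).
have dg (t : R) : is_derive t (1 : R) g ('D_e f (x + t *: e)).
  exact/is_derive_line/derivableP.
have cg (i : interval R) : {within [set` i], continuous g}.
  by apply: derivable_within_continuous => t _; exact: ex_derive.
have g0 : g 0 = f x by rewrite /g scale0r addr0.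
have [s0|s0] := leP 0 s.
  have [t] := MVT_segment s0 (fun t _ => dg t) (cg _).
  rewrite in_itv/= subr0 g0 mulrC => /andP[t0 ts] ->; exists t => //.
  by rewrite !ger0_norm.
have [t] := MVT_segment (ltW s0) (fun t _ => dg t) (cg _).
rewrite in_itv/= sub0r g0 => /andP[ts t0] E; exists t.
  by rewrite !ler0_norm ?lerN2// ltW.
by rewrite -opprB E mulrN opprK mulrC.
Qed.

(** The increment is split at x + h u: the first piece is the known derivative along u, and by the
    mean value theorem the second is h c times ['D_e f] at a point that tends to x. *)
Lemma is_derive_direction_add f x u e (c df : R) :
  (forall y, derivable f y e) -> {for x, continuous ('D_e f)} ->
  is_derive x u f df -> is_derive x (u + c *: e) f (df + c * 'D_e f x).
Proof.
move=> fe cfe [fu <-].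
have D : h^-1 *: (f (h *: (u + c *: e) + x) - f x) @[h --> (0:R)^'] -->
    'D_u f x + c * 'D_e f x.
  have E (h : R) : h^-1 *: (f (h *: (u + c *: e) + x) - f x) =
      h^-1 *: (f (h *: u + x) - f x) +
      h^-1 *: (f ((h *: u + x) + (h * c) *: e) - f (h *: u + x)).
    rewrite -scalerDr addrC; congr (_ *: _).
    rewrite scalerDr scalerA addrAC; lra.
  under eq_fun do rewrite E.
  apply: cvgD; first exact: fu.
  apply/cvgrPdist_lt => eps eps0.
  have [->|c0] := eqVneq c 0.
    by near=> h; rewrite mulr0 scale0r addr0 subrr scaler0 mul0r subrr normr0.
  have c0' : 0 < `|c| by rewrite normr_gt0.
  have /cvgrPdist_lt/(_ (eps / `|c|)) := cfe; rewrite divr_gt0// => /(_ isT).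
  move=> /nbhs_ballP[d d0 xd].
  near=> h.
  have h0 : h != 0 by near: h; exact: nbhs_dnbhs_neq.
  have [t th ->] := mvt_line (h *: u + x) (h * c) fe.
  rewrite -[h * c * _]mulrA [_ *: (_ : R)]mulrA mulVf// mul1r -mulrBr normrM.
  rewrite mulrC -ltr_pdivlMr//; apply: xd.
  rewrite -ball_normE /ball_/= [h *: u + x]addrC -addrA opprD addrA subrr sub0r normrN.
  (* The distance to x is at most |h| (|u| + |c| |e|); the [+ 1] keeps the factor positive. *)
  apply: (@le_lt_trans _ _ (`|h| * (`|u| + `|c| * `|e| + 1))); last first.
    rewrite -ltr_pdivlMr//; near: h.
    by apply: dnbhs0_lt; rewrite divr_gt0.
  apply: (le_trans (ler_normD _ _)); rewrite !normrZ.
  rewrite 2!mulrDr mulr1 -addrA lerD2l mulrA -normrM.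
  by rewrite (le_trans (ler_wpM2r _ th))// lerDl.
split; first by apply: cvgP D.
exact/cvg_lim.
Unshelve. all: by end_near. Qed.

(** [Ck] speaks of partial derivatives only; their continuity yields the derivative in an arbitrary
    direction, one summand at a time. *)
Lemma is_derive_sum_directions (I : Type) (r : seq I) (c : I -> R) (e : I -> V) f x :
  (forall i y, derivable f y (e i)) -> (forall i, {for x, continuous ('D_(e i) f)}) ->
  is_derive x (\sum_(i <- r) c i *: e i) f (\sum_(i <- r) c i * 'D_(e i) f x).
Proof.
move=> fe cfe; elim: r => [|i r IH]; first by rewrite !big_nil; exact: is_derive0.
by rewrite !big_cons addrC [X in is_derive _ _ _ X]addrC; exact: is_derive_direction_add.
Qed.

End chain_rule.

(** * Morrey's inequality *)

Section cone_average.
Context {R : realType}.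

(** The Borel sets of R^n are generated by the open sets, not by the coordinates; the measurability
    of [rV_cons] bridges the two by induction on n. *)
Lemma measurable_rV_coord d (T : measurableType d) n (f : T -> 'rV[R]_n) :
  (forall j, measurable_fun setT (fun x => f x ord0 j)) -> measurable_fun setT f.
Proof.
elim: n => [|n IH] in f * => mf.
  by rewrite (_ : f = cst 0)//; apply/funext => x; rewrite thinmx0.
rewrite (_ : f = @rV_cons R n \o (@rV_uncons R n \o f)); last first.
  by apply/funext => x /=; rewrite rV_unconsK.
apply: measurableT_comp; first exact: measurable_rV_cons.
apply/measurable_fun_pair; last exact: mf.
apply: IH => j; rewrite [X in measurable_fun _ X](_ : _ = (fun x => f x ord0 (lift ord0 j))) ?mf//.
by apply/funext => x /=; rewrite mxE.
Qed.

Lemma measurable_cone n (x : 'rV[R]_n.+1) :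
  measurable_fun setT (fun z : 'rV[R]_n * R => x + z.2 *: rV_cons (z.1, 1)).
Proof.
apply: measurable_rV_coord => j.
rewrite [X in measurable_fun _ X](_ : _ = (fun z : 'rV[R]_n * R =>
   x ord0 j + z.2 * (rV_cons (z.1, 1) ord0 j))); last first.
  by apply/funext => z; rewrite !mxE.
apply: measurable_funD => //; apply: measurable_funM => //.
have [k ->|->] := unliftP ord0 j.
  rewrite [X in measurable_fun _ X](_ : _ = (fun z : 'rV[R]_n => z ord0 k) \o (@fst _ R)).
    apply: measurableT_comp; last exact: measurable_fst.
    exact: (continuous_measurable_rV (@coord_continuous _ _ _ _ _)).
  by apply/funext => z; rewrite !mxE liftK.
rewrite [X in measurable_fun _ X](_ : _ = cst 1)//.
by apply/funext => z; rewrite !mxE unlift_none.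
Qed.

Section cone_integrand.
Variables (n : nat) (x : 'rV[R]_n.+1) (e L : R) (P : 'rV[R]_n.+1 -> \bar R).
Hypotheses (e0 : 0 < e) (mP : measurable_fun setT P) (P0 : forall y, (0 <= P y)%E).

Let h (z : 'rV[R]_n * R) : \bar R :=
  if z.2 \in `[e, L] then ((z.2 ^+ n)%:E * P (x + z.2 *: rV_cons (z.1, 1))%R)%E
  else 0%E.

Let mPc : measurable_fun setT (fun z : 'rV[R]_n * R =>
  P (x + z.2 *: rV_cons (z.1, 1))).
Proof. by apply: measurableT_comp => //; exact: measurable_cone. Qed.

Let mh : measurable_fun setT h.
Proof.
have mI : measurable ((@snd 'rV[R]_n R) @^-1` [set` `[e, L]]).
  by rewrite -[X in measurable X]setTI; exact: measurable_snd.
rewrite (_ : h = (fun z => (z.2 ^+ n)%:E * P (x + z.2 *: rV_cons (z.1, 1))%R)%E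
    \_ ((@snd 'rV[R]_n R) @^-1` [set` `[e, L]])); last first.
  by apply/funext => z; rewrite patchE /h mem_setE.
apply/(measurable_restrictT _ _).1 => //; apply: measurable_funTS.
by apply: emeasurable_funM => //; apply/measurable_EFinP; exact: measurable_funX.
Qed.

Let h0 z : (0 <= h z)%E.
Proof.
rewrite /h; case: ifPn => // /[!in_itv]/= /andP[ez _].
by rewrite mule_ge0// lee_fin exprn_ge0// (le_trans _ ez)// ltW.
Qed.

Let hE w : (\int[lebesgue_measure]_(t in `[e, L])
     ((t ^+ n)%:E * P (x + t *: rV_cons (w, 1))%R) =
  \int[lebesgue_measure]_t h (w, t))%E.
Proof.
rewrite integral_mkcond; apply: eq_integral => t _.
by rewrite /h patchE /= mem_setE.
Qed.

Lemma measurable_cone_integral : measurable_fun setT (fun w =>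
  \int[lebesgue_measure]_(t in `[e, L])
    ((t ^+ n)%:E * P (x + t *: rV_cons (w, 1))%R))%E.
Proof.
rewrite (funext hE).
exact: (@measurable_fun_fubini_tonelli_F _ _ _ _ R (@lebesgue_measure R) _ mh h0).
Qed.

(* The map (w, t) |-> t (w, 1) has Jacobian determinant t ^ n, so that the left-hand
   side is the integral of [P] over part of a cone with vertex [x]. *)
Lemma cone_average_le (Q : set 'rV[R]_n) : measurable Q ->
  (\int[lebesgue_rV n]_(w in Q) \int[lebesgue_measure]_(t in `[e, L])
     ((t ^+ n)%:E * P (x + t *: rV_cons (w, 1))%R)
   <= \int[lebesgue_rV n.+1]_y P y)%E.
Proof.
move=> mQ; under eq_integral do rewrite hE.
have mF := @measurable_fun_fubini_tonelli_F _ _ _ _ R (@lebesgue_measure R) _ mh h0.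
apply: (@le_trans _ _ (\int[lebesgue_rV n]_w \int[lebesgue_measure]_t h (w, t))%E).
  apply: ge0_subset_integral => //.
  by move=> w _; exact: integral_ge0.
have E1 := @fubini_tonelli _ _ _ _ R (leb n) (@lebesgue_measure R) h mh h0.
rewrite [leLHS](_ : _ = \int[lebesgue_measure]_t \int[leb n]_w h (w, t))%E; last exact: E1.
have mPx : measurable_fun setT (fun y : 'rV[R]_n.+1 => P (x + 1 *: y)).
  by apply: measurableT_comp => //; exact: measurable_rV_affine.
(* A dilation by 1, that is, the translation moving the vertex x to the origin. *)
rewrite -(ge0_integral_rV_affine x ltr01 mP)// expr1n mul1e.
rewrite ge0_integral_rV_cons//.
apply: ge0_le_integral => //.
- by move=> t _; exact: integral_ge0.
- exact: (@measurable_fun_fubini_tonelli_G _ _ _ _ R (leb n) _ mh h0).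
- exact: (measurable_integral_rV_cons mPx).
move=> t _; have [|tI] := boolP (t \in `[e, L]); last first.
  rewrite integral0_eq => [|w _]; last by rewrite /h/= (negbTE tI).
  by apply: integral_ge0 => ? _; exact: P0.
rewrite /h/= => tI; under eq_integral do rewrite tI.
move: tI; rewrite in_itv/= => /andP[et _]; have t0 := lt_le_trans e0 et.
have mPt : measurable_fun setT (fun z : 'rV[R]_n => P (x + 1 *: rV_cons (z, t))).
  exact: (measurable_rV_cons_section t mPx).
(* For fixed t the weight t ^ n is the Jacobian of w |-> t w, so the slice of the cone integral is
   bounded by the integral of [P] over the hyperplane at height t above x. *)
rewrite -(ge0_integral_rV_affine 0 t0 mPt)//.
rewrite ge0_integralZl//; last 2 first.
- exact: (measurableT_comp mPc (measurable_pair2 t)).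
- by rewrite lee_fin exprn_ge0// ltW.
apply: lee_wpmul2l; first by rewrite lee_fin exprn_ge0// ltW.
rewrite le_eqVlt; apply/orP; left; apply/eqP.
apply: eq_integral => w _; congr P; rewrite scale1r add0r; congr (_ + _).
by apply/rowP => j; rewrite !mxE; case: unliftP => [k|] _; rewrite /= ?mxE ?mulr1.
Qed.

End cone_integrand.

End cone_average.

(** * Estimates along rays *)

Section morrey.
Context {R : realType}.

Lemma FTC_is_derive (g dg : R -> R) (a b : R) : a < b ->
  (forall t : R, 0 < t -> is_derive t (1:R) g (dg t)) -> 0 < a ->
  {within `[a, b], continuous dg} ->
  (\int[lebesgue_measure]_(t in `[a, b]) (dg t)%:E = (g b)%:E - (g a)%:E)%E.
Proof.
move=> ab dgE a0 cdg.
have cg (t : R) : 0 < t -> {for t, continuous g}.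
  move=> t0; apply/differentiable_continuous/derivable1_diffP.
  by have := dgE t t0 => ?; exact: ex_derive.
apply: continuous_FTC2 => //.
- split.
  + by move=> t; rewrite in_itv/= => /andP[/(lt_trans a0) t0 _]; case: (dgE t t0).
  + by apply: cvg_at_right_filter; exact: cg.
  + by apply: cvg_at_left_filter; apply: cg; exact: lt_trans ab.
- move=> t; rewrite in_itv/= => /andP[/(lt_trans a0) t0 _].
  by rewrite derive1E; case: (dgE t t0).
Qed.

(** The value of the primitive at e is dropped, which makes the bound independent of e. *)
Lemma integral_powR_bound (r e L : R) : 0 <= r < 1 -> 0 < e -> e < L ->
  (\int[lebesgue_measure]_(t in `[e, L]) (t `^ (- r))%:E <=
   (L `^ (1 - r) / (1 - r))%:E)%E.
Proof.
move=> /andP[r0 r1] e0 eL; have r10 : 1 - r != 0 by rewrite subr_eq0 gt_eqF.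
have dF (t : R) : 0 < t -> is_derive t (1:R) (fun t : R => t `^ (1 - r) / (1 - r)) (t `^ (- r)).
  move=> t0.
  have D : is_derive t (1:R) (fun u : R => powR u (1 - r)) ((1 - r) * t `^ (1 - r - 1)).
    exact: is_derive1_powR.
  have E : is_derive t (1:R) (cst (1 - r)^-1 : R -> R) 0 by exact: is_derive_cst.
  have := is_deriveM D E.
  move=> /is_derive_eq; apply.
  by rewrite /= scaler0 add0r (addrAC 1) subrr add0r -[_ *: _]/(_ * _) mulrA mulVf// mul1r.
have cF : {within `[e, L], continuous (fun t => t `^ (- r))}.
  apply: derivable_within_continuous => t; rewrite in_itv/= => /andP[et _].
  by have := is_derive1_powR (- r) (lt_le_trans e0 et) => ?; exact: ex_derive.
rewrite (FTC_is_derive eL dF e0 cF) -EFinB lee_fin gerBl divr_ge0 ?powR_ge0//.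
by rewrite subr_ge0 ltW.
Qed.

(* Young's inequality for the factors a t^(n/s) and t^(-n/s); the power of t on the
   right is integrable at 0 exactly when n.+1 < s. *)
Lemma young_weight (n : nat) (s a t : R) : n.+1%:R < s -> 0 <= a -> 0 < t ->
  a <= a `^ s * t ^+ n + t `^ (- (n%:R / (s - 1))).
Proof.
move=> ns a0 t0.
have s1 : 1 < s by rewrite (le_lt_trans _ ns)// ler1n.
have s0 : 0 < s by lra.
have s10 : 0 < s - 1 by lra.
have t00 : t != 0 by rewrite gt_eqF.
have := @conjugate_powR _ (a * t `^ (n%:R / s)) (t `^ (- (n%:R / s))) s (s / (s - 1)).
have -> : a * t `^ (n%:R / s) * t `^ (- (n%:R / s)) = a.
  by rewrite -mulrA -powRD ?t00 ?implybT// subrr powRr0 mulr1.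
have -> : (a * t `^ (n%:R / s)) `^ s = a `^ s * t ^+ n.
  by rewrite powRM ?powR_ge0// -powRrM divfK ?gt_eqF// powR_mulrn// ltW.
have -> : (t `^ (- (n%:R / s))) `^ (s / (s - 1)) = t `^ (- (n%:R / (s - 1))).
  by rewrite -powRrM; congr (_ `^ _); field; rewrite !gt_eqF.
rewrite mulr_ge0 ?powR_ge0// divr_gt0//.
move=> /(_ isT isT s0 isT) H; apply: (le_trans (H _)).
  by field; rewrite !gt_eqF.
have inv1 : s^-1 <= 1 by rewrite invf_le1// ltW.
have inv2 : (s / (s - 1))^-1 <= 1 by rewrite invf_div ler_pdivrMr//; lra.
apply: lerD; first by rewrite ler_piMr// mulr_ge0 ?powR_ge0 ?exprn_ge0// ltW.
by rewrite ler_piMr// powR_ge0.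
Qed.

(** Since phi vanishes at the far end, its value at the near end is an integral of its derivative
    along the ray. The coordinates of (w, 1) are at most 1, so Young's inequality applies to each
    partial derivative separately; this is the origin of the factor [n.+1]. *)
Lemma ray_bound n (s : R) (phi : 'rV[R]_n.+1 -> R) (x : 'rV[R]_n.+1)
    (w : 'rV[R]_n) (e L : R) :
  n.+1%:R < s -> 0 < e -> e < L -> (forall j, `|w ord0 j| <= 1) -> Ck 1 phi ->
  phi (x + L *: rV_cons (w, 1)) = 0 ->
  (`|phi (x + e *: rV_cons (w, 1))|%:E <=
    \int[lebesgue_measure]_(t in `[e, L]) ((t ^+ n)%:E *
      \sum_(i < n.+1) (`|'D_(delta_mx ord0 i) phi (x + t *: rV_cons (w, 1))%R| `^ s)%:E) +
    (n.+1%:R * (L `^ (1 - n%:R / (s - 1)) / (1 - n%:R / (s - 1))))%:E)%E.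
Proof.
move=> ns e0 eL w1 [cphi Dphi] phiL0.
have s1 : 1 < s by rewrite (le_lt_trans _ ns)// ler1n.
set v := rV_cons (w, 1).
have v1 i : `|v ord0 i| <= 1.
  by rewrite mxE; case: unliftP => [j|] _ /=; rewrite ?normr1.
have vE : v = \sum_(i < n.+1) v ord0 i *: delta_mx ord0 i by exact: row_sum_delta.
pose D i y := 'D_(delta_mx ord0 i) phi y.
pose dg (t : R) := \sum_(i < n.+1) v ord0 i * D i (x + t *: v).
have dE (t : R) : is_derive t (1:R) (fun t => phi (x + t *: v)) (dg t).
  apply: is_derive_line; rewrite [X in is_derive _ X]vE.
  apply: is_derive_sum_directions => i; first exact: (Dphi i).1.
  exact: (Dphi i).2.1.
have cline : continuous (fun t : R => x + t *: v).
  move=> t; apply: (@continuousD _ _ _ (cst x) (fun t : R => t *: v)).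
    exact: cst_continuous.
  exact: scalel_continuous.
have cD i : continuous (fun t : R => D i (x + t *: v)).
  move=> t; apply: continuous_comp; first exact: cline.
  exact: (Dphi i).2.1.
have cdg : continuous dg.
  move=> t; apply: cvg_big => [|i _]; first exact: add_continuous.
  by apply: cvgM; [exact: cvg_cst|exact: cD].
have E := FTC_is_derive eL (fun t _ => dE t) e0 (continuous_subspaceT cdg).
move: E; rewrite phiL0 -EFinB sub0r => E.
rewrite -normrN -abse_EFin -E.
set r := n%:R / (s - 1).
have r01 : 0 <= r < 1.
  rewrite /r divr_ge0 ?ler0n ?subr_ge0 ?(ltW s1)//= ltr_pdivrMr ?subr_gt0//.
  by rewrite mul1r ltrBrDr natr1.
have mdg : measurable_fun `[e, L] dg by apply: measurable_funTS; exact: continuous_measurable_fun.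
have mD i : measurable_fun `[e, L] (fun t => D i (x + t *: v)).
  by apply: measurable_funTS; exact: continuous_measurable_fun.
pose G (t : R) := \sum_(i < n.+1) `|D i (x + t *: v)| `^ s.
have mG : measurable_fun `[e, L] (fun t => t ^+ n * G t).
  apply: measurable_funM; first exact: measurable_funX.
  apply: measurable_sum => i; apply: (measurableT_comp (measurable_powR _)).
  exact: measurableT_comp.
have mr : measurable_fun `[e, L] (fun t => t `^ (- r)).
  exact: measurable_funTS.
have -> : (\int[lebesgue_measure]_(t in `[e, L]) ((t ^+ n)%:E *
      \sum_(i < n.+1) (`|'D_(delta_mx ord0 i) phi (x + t *: v)%R| `^ s)%:E) =
    \int[lebesgue_measure]_(t in `[e, L]) (t ^+ n * G t)%:E)%E.
  by apply: eq_integral => t _; rewrite sumEFin EFinM.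
apply: le_trans (le_abse_integral _ _ _) _ => //; first exact/measurable_EFinP.
have It (t : R) : t \in `[e, L] -> 0 < t.
  by rewrite in_itv/= => /andP[et _]; exact: lt_le_trans et.
have G0 t : 0 <= G t by apply: sumr_ge0 => i _; exact: powR_ge0.
apply: (@le_trans _ _ (\int[lebesgue_measure]_(t in `[e, L])
   ((t ^+ n * G t)%:E + (n.+1%:R%:E * (t `^ (- r))%:E)))%E).
  apply: ge0_le_integral => //=.
  - by apply/measurable_EFinP; exact: measurableT_comp.
  - apply: emeasurable_funD; first exact/measurable_EFinP.
    by apply: emeasurable_funM => //; exact/measurable_EFinP.
  - move=> t /It t0; rewrite -EFinM -EFinD lee_fin.
    apply: le_trans (ler_norm_sum _ _ _) _.
    have -> : n.+1%:R * t `^ (- r) = \sum_(i < n.+1) t `^ (- r).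
      by rewrite sumr_const card_ord mulr_natl.
    rewrite /G mulr_sumr -big_split/=.
    apply: ler_sum => i _; rewrite normrM.
    apply: (@le_trans _ _ `|D i (x + t *: v)|); first by rewrite ler_piMl.
    by rewrite [t ^+ n * _]mulrC; exact: young_weight.
rewrite ge0_integralD//=; last 4 first.
- by move=> t /It t0; rewrite lee_fin mulr_ge0// exprn_ge0// ltW.
- exact/measurable_EFinP.
- by move=> t /It t0; rewrite -EFinM lee_fin mulr_ge0// powR_ge0.
- by apply: emeasurable_funM => //; exact/measurable_EFinP.
rewrite leeD2l// ge0_integralZl//=; last 2 first.
- exact/measurable_EFinP.
- by move=> t _; rewrite lee_fin powR_ge0.
by rewrite EFinM; apply: lee_wpmul2l; [rewrite lee_fin|exact: integral_powR_bound].
Qed.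

End morrey.

Section sup_bound.
Context {R : realType}.

(* Not homogeneous in [phi]: the bound is scaled in [test_fun_sup_bound]. *)
Lemma Ck1_sup_bound n (s M : R) (phi : 'rV[R]_n.+1 -> R) (x : 'rV[R]_n.+1) :
  n.+1%:R < s -> 0 < M -> Ck 1 phi ->
  (forall y, phi y != 0 -> `|y ord0 ord0| < M) ->
  (`|phi x|%:E <= \int[lebesgue_rV n.+1]_y
      \sum_(i < n.+1) (`|'D_(delta_mx ord0 i) phi y| `^ s)%:E +
    (n.+1%:R * ((2 * M) `^ (1 - n%:R / (s - 1)) / (1 - n%:R / (s - 1))))%:E)%E.
Proof.
move=> ns M0 cphi suppM.
have s1 : 1 < s by rewrite (le_lt_trans _ ns)// ler1n.
set C := (n.+1%:R * _).
have C0 : 0 <= C.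
  rewrite mulr_ge0// divr_ge0 ?powR_ge0// subr_ge0 ler_pdivrMr ?subr_gt0// mul1r.
  by rewrite lerBrDr natr1 ltW.
pose P (y : 'rV[R]_n.+1) : \bar R := (\sum_(i < n.+1) (`|'D_(delta_mx ord0 i) phi y| `^ s)%:E)%E.
have P0 y : (0 <= P y)%E by apply: sume_ge0 => i _; rewrite lee_fin powR_ge0.
have mP : measurable_fun setT P.
  apply: emeasurable_sum => i; apply/measurable_EFinP.
  apply: (measurableT_comp (measurable_powR _)); apply: measurableT_comp => //.
  by apply: continuous_measurable_rV; have [_ /(_ i)[_ []]] := cphi.
rewrite [X in (X + _)%E](_ : _ = \int[lebesgue_rV n.+1]_y P y)%E//.
(* The coordinate bound on x, which makes all rays leave the support, is available only where phi x
   is nonzero. *)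
have [x0|xM] := eqVneq (phi x) 0.
  by rewrite x0 normr0; apply: adde_ge0; [apply: integral_ge0 => y _; exact: P0|rewrite lee_fin].
have {}xM := suppM _ xM.
apply/lee_addgt0Pr => eta eta0.
have [cphi0 _] := cphi.
have /cvgrPdist_lt/(_ _ eta0)/nbhs_ballP[d /= d0 xd] := cphi0 x.
(* Rays start at parameter e instead of 0: below d, so that phi changes by less than eta, and below
   the end 2 M. *)
pose e := Num.min (d / 2) M.
have e0 : 0 < e by rewrite lt_min divr_gt0.
have eL : e < 2 * M by rewrite gt_min; apply/orP; right; lra.
(* The radius 1/2 gives the cube of directions unit volume, so integrating over it is averaging. *)
have Q1 : lebesgue_rV n (ball (0 : 'rV[R]_n) 2^-1) = 1%E.
  by rewrite lebesgue_rV_ball ?invr_gt0 ?ltr0n// divff ?pnatr_eq0// expr1n.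
pose h w := (\int[lebesgue_measure]_(t in `[e, (2 * M)%R])
     ((t ^+ n)%:E * P (x + t *: rV_cons (w, 1))%R))%E.
have key (w : 'rV[R]_n) : ball (0 : 'rV[R]_n) 2^-1 w -> (`|phi x|%:E <= h w + C%:E + eta%:E)%E.
  move=> [_ w2].
  have w1 j : `|w ord0 j| <= 1.
    have := w2 ord0 j; rewrite -ball_normE /ball_/= mxE sub0r normrN => /ltW/le_trans; apply.
    by rewrite invf_le1 ?ler1n.
  (* The coordinate 0 increases at unit speed along the ray; starting above - M it exceeds M at
     parameter 2 M. *)
  have L0 : phi (x + (2 * M) *: rV_cons (w, 1)) = 0.
    apply/eqP/negbNE/negP => /suppM; rewrite !mxE unlift_none/= mulr1.
    by rewrite ltr_norml => /andP[_]; move: xM; rewrite ltr_norml => /andP[]; lra.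
  have := ray_bound ns e0 eL w1 cphi L0; rewrite -/C -/(h w) => H.
  apply: (@le_trans _ _ (`|phi (x + e *: rV_cons (w, 1))|%:E + eta%:E)%E); last exact: leeD.
  have : ball x d (x + e *: rV_cons (w, 1)).
    split => // i j; rewrite ord1 -ball_normE /ball_/= !mxE opprD addrA subrr sub0r normrN.
    rewrite normrM gtr0_norm//.
    apply: (@le_lt_trans _ _ e).
      rewrite ler_piMr ?(ltW e0)//.
      by case: unliftP => [k|] _ /=; rewrite ?normr1.
    by rewrite gt_min; apply/orP; left; lra.
  move=> /xd; rewrite -EFinD lee_fin => H1.
  rewrite -lerBlDl; apply: ltW; apply: le_lt_trans H1.
  by apply: le_trans (lerB_dist _ _); rewrite lerB.
(* The averaging below compares integrals of nonnegative functions, so a nonpositive constant is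
   treated apart. *)
have [a0|a0] := leP (`|phi x| - C - eta) 0.
  rewrite -addeA; apply: (@le_trans _ _ (C + eta)%:E); first by rewrite lee_fin; lra.
  by rewrite EFinD leeDr// integral_ge0.
suff : ((`|phi x| - C - eta)%:E <= \int[lebesgue_rV n.+1]_y P y)%E.
  move=> H; rewrite -addeA -EFinD; apply: le_trans (leeD2r _ H).
  by rewrite -EFinD lee_fin; lra.
have mQ : measurable (ball (0 : 'rV[R]_n) 2^-1).
  by apply: open_measurable_rV; exact: ball_open.
apply: (le_trans _ (cone_average_le x (2 * M) e0 mP P0 mQ)).
rewrite -[leLHS]mule1 -Q1 -integral_cst//.
apply: ge0_le_integral => //.
- by move=> w _; rewrite lee_fin ltW.
- by apply: measurable_funTS; exact: measurable_cone_integral.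
move=> w Qw; have := key w Qw; rewrite -/(h w).
by case: (h w) => [r||//]; rewrite ?leey// -!EFinD !lee_fin; lra.
Qed.

End sup_bound.

(** * Sobolev spaces *)

Section Lnorm_restricted.
Context d (T : measurableType d) {R : realType} (mu : {measure set T -> \bar R}).
Variables (D : set T) (mD : measurable D).
Local Notation N r f := ('N[mu]_r%:E[EFin \o (f \_ D)])%E.
Implicit Types (f g : T -> R) (r a : R).

Lemma poweR_Lnorm_restrict r f : r != 0 ->
  (N r f `^ r = \int[mu]_(x in D) (`|f x| `^ r)%:E)%E.
Proof.
move=> r0; apply: etrans (poweR_Lnorm mu (EFin \o (f \_ D)) r0) _.
apply: etrans _ (esym (integral_mkcond _ _)).
apply: eq_integral => x _.
by rewrite /= !patchE; case: ifPn => // _; rewrite normr0 powR0.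
Qed.

Lemma measurable_restrict0 f : measurable_fun D f -> measurable_fun setT (f \_ D).
Proof. by move=> mf; apply/(measurable_restrictT _ mD).1. Qed.

Lemma Lnorm_restrictD r f g : 1 <= r -> measurable_fun D f -> measurable_fun D g ->
  (N r (fun x => f x + g x)%R <= N r f + N r g)%E.
Proof.
move=> r1 mf mg.
rewrite (_ : (fun x => f x + g x) \_ D = (f \_ D) \+ (g \_ D))%R.
  by apply: minkowski_EFin => //; exact: measurable_restrict0.
by apply/funext => x; rewrite /= !patchE; case: ifPn; rewrite ?addr0.
Qed.

Lemma Lnorm_restrictZ r a f : 0 < r -> measurable_fun D f ->
  (N r (fun x => a * f x)%R = `|a|%:E * N r f)%E.
Proof.
move=> r0 mf; have r0' : r != 0 by rewrite gt_eqF.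
rewrite unlock /Lnorm.
have -> : (\int[mu]_x (`|(EFin \o (fun x => (a * f x)%R) \_ D) x| `^ r) =
  (`|a| `^ r)%:E * \int[mu]_x (`|(EFin \o f \_ D) x| `^ r))%E.
  rewrite -ge0_integralZl//.
  - apply: eq_integral => x _ /=; rewrite !patchE; case: ifPn => _.
      by rewrite normrM powRM// EFinM.
    by rewrite normr0 powR0// mule0.
  - apply: (measurableT_comp (measurable_poweR _)); apply: measurableT_comp => //.
    exact/measurable_EFinP/measurable_restrict0.
  - by move=> x _; exact: poweR_ge0.
rewrite poweRM; [|by rewrite lee_fin powR_ge0|by apply: integral_ge0 => x _; exact: poweR_ge0].
by rewrite poweR_EFin -powRrM divff// powRr1.
Qed.

Lemma Lnorm_restrictN r f : (N r (fun x => - f x)%R = N r f)%E.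
Proof.
rewrite -[RHS]oppe_Lnorm; apply: eq_Lnorm => x /=; rewrite !patchE.
by case: ifPn => //; rewrite oppr0.
Qed.

Lemma eq_Lnorm_restrict r f g : {in D, f =1 g} -> N r f = N r g.
Proof.
move=> fg; apply: eq_Lnorm => x /=; rewrite !patchE.
by case: ifPn => // xD; rewrite fg.
Qed.

Lemma Lnorm_restrict_eq0 r f : 0 < r -> measurable_fun D f -> N r f = 0%E ->
  {ae mu, forall x, D x -> f x = 0}.
Proof.
move=> r0 mf N0.
have mF : measurable_fun setT (EFin \o (f \_ D)).
  exact/measurable_EFinP/measurable_restrict0.
have r0' : (0 < r%:E)%E by rewrite lte_fin.
have := Lnorm_eq0_eq0 mF r0' N0; apply: filterS => x /(_ I)/= + Dx.
by rewrite patchE mem_set// => -[].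
Qed.

Lemma Lnorm_restrict_cst_le r a f : 0 < r -> 0 <= a -> measurable_fun D f ->
  (forall x, D x -> `|f x| <= a) ->
  (N r f <= a%:E * mu D `^ r^-1)%E.
Proof.
move=> r0 a0 mf fa.
rewrite -[leLHS]poweRe1 ?Lnorm_ge0// -(divff (lt0r_neq0 r0)) poweRrM.
rewrite (poweR_Lnorm_restrict _ (lt0r_neq0 r0)).
have -> : (a%:E * mu D `^ r^-1 = ((a `^ r)%:E * mu D) `^ r^-1)%E.
  rewrite poweRM ?lee_fin ?powR_ge0//.
  by rewrite poweR_EFin -powRrM divff ?lt0r_neq0// powRr1.
rewrite gt0_ler_poweR ?invr_ge0 ?(ltW r0)//.
- rewrite in_itv/= leey andbT; apply: integral_ge0 => x _.
  by rewrite lee_fin powR_ge0.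
- by rewrite in_itv/= leey andbT mule_ge0// lee_fin powR_ge0.
have -> : ((a `^ r)%:E * mu D = \int[mu]_(x in D) (cst (a `^ r)%:E) x)%E.
  by rewrite integral_cst.
apply: ge0_le_integral => //=.
- apply/measurable_EFinP; apply: (measurableT_comp (measurable_powR _)).
  exact: measurableT_comp.
by move=> x Dx; rewrite lee_fin ge0_ler_powR ?(ltW r0) ?nnegrE// fa.
Qed.

(** Only finiteness is wanted, so the pointwise Young inequality takes the place of Hölder's. *)
Lemma integrable_mul_conjugate r r' f g : 0 < r -> 0 < r' -> r^-1 + r'^-1 = 1 ->
  measurable_fun D f -> measurable_fun D g ->
  (N r f < +oo)%E -> (N r' g < +oo)%E ->
  mu.-integrable D (EFin \o (fun x => f x * g x)).
Proof.
move=> r0 r'0 rr' mf mg Nf Ng.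
apply/integrableP; split; first exact/measurable_EFinP/measurable_funM.
have mp (h : T -> R) (s : R) : measurable_fun D h -> measurable_fun D (fun x => (`|h x| `^ s / s)%:E).
  move=> mh; apply/measurable_EFinP; apply: measurable_funM => //.
  by apply: (measurableT_comp (measurable_powR _)); exact: measurableT_comp.
apply: (@le_lt_trans _ _ (\int[mu]_(x in D)
    ((`|f x| `^ r / r)%:E + (`|g x| `^ r' / r')%:E))%E).
  apply: ge0_le_integral => //=.
  - by apply/measurable_EFinP; apply: measurableT_comp => //; exact: measurable_funM.
  - by apply: emeasurable_funD; exact: mp.
  by move=> x _; rewrite -EFinD lee_fin normrM; exact: conjugate_powR.
have fin (h : T -> R) (s : R) : 0 < s -> measurable_fun D h -> (N s h < +oo)%E ->
    (\int[mu]_(x in D) (`|h x| `^ s / s)%:E < +oo)%E.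
  move=> s0 mh Nh; under eq_integral do rewrite EFinM.
  rewrite ge0_integralZr//=.
  - rewrite -poweR_Lnorm_restrict ?lt0r_neq0//.
    have := poweR_lty s Nh; have := poweR_ge0 (N s h) s.
    by case: (_ `^ s)%E => // z _ _; rewrite -EFinM ltry.
  - apply/measurable_EFinP; apply: (measurableT_comp (measurable_powR _)).
    exact: measurableT_comp.
  - by rewrite lee_fin invr_ge0 ltW.
rewrite ge0_integralD//=.
- by rewrite lte_add_pinfty// fin.
- by move=> x _; rewrite lee_fin divr_ge0 ?powR_ge0// ltW.
- exact: mp.
- by move=> x _; rewrite lee_fin divr_ge0 ?powR_ge0// ltW.
- exact: mp.
Qed.

End Lnorm_restricted.

Section sobolev_space.
Context {R : realType} {d : nat}.
Variable Om : set 'rV[R]_d.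
Hypotheses (oOm : open Om) (bOm : bounded_set Om).
Local Notation mu := (@lebesgue_rV R d).
Local Notation N r f := ('N[mu]_r%:E[EFin \o (f \_ Om)])%E.
Local Notation D i f := ('D_(delta_mx ord0 i) f).
Implicit Types (y z v : @sobolev_fun R d) (phi psi : 'rV[R]_d -> R) (a r s : R).

Let mOm : measurable Om. Proof. exact: open_measurable_rV. Qed.

Lemma bounded_set_ball : exists2 M : R, 0 < M & Om `<=` ball 0 M.
Proof.
have [M [_ HM]] := bOm; exists (Num.max M 0 + 2); first by rewrite ltr_wpDl// le_max lexx orbT.
move=> x Omx; rewrite -ball_normE /ball_/= sub0r normrN.
apply: (@le_lt_trans _ _ (Num.max M 0 + 1)); last by rewrite ltrD2l ltr1n.
by apply: HM => //; rewrite ltr_pwDr// le_max lexx.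
Qed.

Lemma lebesgue_bounded_lty : (mu Om < +oo)%E.
Proof.
have [M M0 OmM] := bounded_set_ball.
apply: (@le_lt_trans _ _ (mu (ball 0 M))).
  by apply: le_measure => //; rewrite inE//; apply: open_measurable_rV; exact: ball_open.
by rewrite lebesgue_rV_ball// ltry.
Qed.

Lemma in_LpD r f g : 1 <= r -> in_Lp Om r f -> in_Lp Om r g ->
  in_Lp Om r (fun x => f x + g x).
Proof.
move=> r1 [mf Nf] [mg Ng]; split; first exact: measurable_funD.
by apply: le_lt_trans (Lnorm_restrictD mu mOm r1 mf mg) _; exact: lte_add_pinfty.
Qed.

Lemma in_LpZ r a f : 0 < r -> in_Lp Om r f -> in_Lp Om r (fun x => a * f x).
Proof.
move=> r0 [mf Nf]; split; first exact: measurable_funM.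
rewrite (Lnorm_restrictZ mu mOm)//; move: (Lnorm_ge0 mu r%:E (EFin \o (f \_ Om))) Nf.
by case: ('N[mu]__[_])%E => // x _ _; rewrite -EFinM ltry.
Qed.

Lemma continuous_lin a phi psi : continuous phi -> continuous psi ->
  continuous (fun x => a * phi x + psi x).
Proof.
move=> cphi cpsi x.
apply: (@continuousD _ _ _ (fun x => a * phi x) psi); last exact: cpsi.
by apply: (@continuousM _ _ (cst a) phi); [exact: cst_continuous|exact: cphi].
Qed.

Lemma Ck_lin k a phi psi : Ck k phi -> Ck k psi ->
  Ck k (fun x => a * phi x + psi x).
Proof.
elim: k => [|k IH] in phi psi *; move=> [cphi Dphi] [cpsi Dpsi];
    (split; first exact: continuous_lin) => //.
move=> i; have [dphi Cphi] := Dphi i; have [dpsi Cpsi] := Dpsi i.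
have E x : is_derive x (delta_mx ord0 i) (fun x => a * phi x + psi x)
    (a * D i phi x + D i psi x).
  have H1 : is_derive x (delta_mx ord0 i) (a *: phi) (a *: D i phi x).
    by apply: is_deriveZ; exact: derivableP.
  have H2 : is_derive x (delta_mx ord0 i) psi (D i psi x) by exact: derivableP.
  exact: (is_deriveD H1 H2).
split; first by move=> x; case: (E x).
rewrite (_ : D i (fun x => a * phi x + psi x) = (fun x => a * D i phi x + D i psi x)).
  exact: IH.
by apply/funext => x; case: (E x).
Qed.

Lemma test_funE phi x : test_fun Om phi -> phi x != 0 -> Om x.
Proof. by move=> [_ _ s] px; apply: s; exact: subset_closure. Qed.

Lemma derive_test_fun_lin a phi psi i : test_fun Om phi -> test_fun Om psi ->
  D i (fun x => a * phi x + psi x) = (fun x => a * D i phi x + D i psi x).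
Proof.
move=> [cphi _ _] [cpsi _ _]; have [_ /(_ i)[dphi _]] := cphi 1%N.
have [_ /(_ i)[dpsi _]] := cpsi 1%N; apply/funext => x.
have H1 : is_derive x (delta_mx ord0 i) (a *: phi) (a *: D i phi x).
  by apply: is_deriveZ; exact: derivableP.
have H2 : is_derive x (delta_mx ord0 i) psi (D i psi x) by exact: derivableP.
by case: (is_deriveD H1 H2).
Qed.

Lemma test_fun_lin a phi psi : test_fun Om phi -> test_fun Om psi ->
  test_fun Om (fun x => a * phi x + psi x).
Proof.
move=> [Cphi kphi sphi] [Cpsi kpsi spsi].
have sub : closure [set x | a * phi x + psi x != 0] `<=`
    closure [set x | phi x != 0] `|` closure [set x | psi x != 0].
  rewrite -closureU; apply: closure_subset => x /=.
  have [->|] := eqVneq (phi x) 0; last by left.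
  by rewrite mulr0 add0r; right.
split.
- by move=> k; exact: Ck_lin.
- apply: (subclosed_compact _ (compactU kphi kpsi) sub); exact: closed_closure.
- by move=> x /sub [/sphi|/spsi].
Qed.

(** A point outside [Om] has a whole neighbourhood off the closed support. This turns integrals of
    derivatives over R^n, as in Morrey's inequality, into integrals over [Om]. *)
Lemma test_fun_derive0 phi i x : test_fun Om phi -> ~ Om x -> D i phi x = 0.
Proof.
move=> [Cphi _ sphi] nOmx.
pose K := closure [set x | phi x != 0].
have nKx : (~` K) x by move=> /sphi.
have oK : open (~` K) by apply: closed_openC; exact: closed_closure.
have /nbhs_ballP[e /= e0 eK] := open_nbhs_nbhs (conj oK nKx).
have z0 (u : 'rV[R]_d) : (~` K) u -> phi u = 0.
  by move=> Ku; apply/eqP/negbNE/negP => ?; apply: Ku; exact: subset_closure.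
rewrite /derive; apply/cvg_lim => //.
pose m : R := `|delta_mx ord0 i : 'rV[R]_d|.
have m0 : 0 < m + 1 by rewrite ltr_wpDl// /m normr_ge0.
apply: cvg_near_cst; near=> h.
rewrite /= (z0 x nKx) z0 ?subrr ?scaler0//.
apply: eK; rewrite -ball_normE /ball_/= opprD addrCA subrr addr0 normrN normrZ.
rewrite -/m.
apply: (@le_lt_trans _ _ (`|h| * (m + 1))); first by rewrite ler_wpM2l// lerDl.
rewrite -ltr_pdivlMr//; near: h; apply: dnbhs0_lt.
exact: divr_gt0.
Unshelve. all: by end_near. Qed.

Lemma bounded_closure_compact : compact (closure Om).
Proof.
apply: bounded_closed_compact; last exact: closed_closure.
have [M M0 OmM] := bounded_set_ball.
have sub : closure Om `<=` [set x | `|x| <= M].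
  rewrite [X in _ `<=` X](closure_id _).1; last first.
    apply: (@closed_comp _ _ (fun x : 'rV[R]_d => `|x|) [set t | t <= M]).
      by move=> x _; exact: norm_continuous.
    exact: closed_le.
  apply: closure_subset => x /OmM; rewrite -ball_normE /ball_/= sub0r normrN.
  exact: ltW.
exists M; split; first exact: num_real.
by move=> t Mt x /sub /= xM; rewrite (le_trans xM)// ltW.
Qed.

Lemma continuous_bounded_closure (f : 'rV[R]_d -> R) : continuous f ->
  exists2 B : R, 0 <= B & forall x, Om x -> `|f x| <= B.
Proof.
move=> cf; have [->|/set0P Om0] := eqVneq Om set0; first by exists 0.
have cnf : {within closure Om, continuous (fun x => `|f x|)}.
  apply: continuous_subspaceT => x; apply: continuous_comp; first exact: cf.
  exact: norm_continuous.
have clOm0 : closure Om !=set0.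
  by have [x Omx] := Om0; exists x; exact: subset_closure.
have [c _ Hc] := compact_EVT_max clOm0 bounded_closure_compact cnf.
by exists `|f c| => // x Omx; apply: Hc; rewrite inE; exact: subset_closure.
Qed.

Lemma continuous_in_Lp r (f : 'rV[R]_d -> R) : 0 < r -> continuous f -> in_Lp Om r f.
Proof.
move=> r0 cf; have [B B0 fB] := continuous_bounded_closure cf.
have mf : measurable_fun Om f by apply: measurable_funTS; exact: continuous_measurable_rV.
split => //; apply: le_lt_trans (Lnorm_restrict_cst_le mu mOm r0 B0 mf fB) _.
have := poweR_lty r^-1 lebesgue_bounded_lty; have := poweR_ge0 (mu Om) r^-1.
by case: (_ `^ _)%E => // t _ _; rewrite -EFinM ltry.
Qed.

Lemma test_fun_in_Lp r phi : 0 < r -> test_fun Om phi ->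
  in_Lp Om r phi /\ forall i, in_Lp Om r (D i phi).
Proof.
move=> r0 [Cphi _ _]; have [cphi Dphi] := Cphi 1%N; split; first exact: continuous_in_Lp.
by move=> i; apply: continuous_in_Lp => //; exact: (Dphi i).2.1.
Qed.

End sobolev_space.

Section W1_space.
Context {R : realType} {d : nat}.
Variable Om : set 'rV[R]_d.
Hypotheses (oOm : open Om) (bOm : bounded_set Om).
Local Notation mu := (@lebesgue_rV R d).
Local Notation N r f := ('N[mu]_r%:E[EFin \o (f \_ Om)])%E.
Local Notation D i f := ('D_(delta_mx ord0 i) f).
Implicit Types (y z v w : @sobolev_fun R d) (phi psi : 'rV[R]_d -> R) (a r s : R).

Let mOm : measurable Om. Proof. exact: open_measurable_rV. Qed.

(* The pairs for which [W1norm Om r] behaves as a seminorm; unlike [W1], no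
   relation between the two components is required. *)
Definition W1_Lp r y := in_Lp Om r y.1 /\ forall i, in_Lp Om r (y.2 i).

Lemma W1_W1_Lp r y : W1 Om r y -> W1_Lp r y.
Proof. by case. Qed.

Lemma W1_Lp_lin r a y z : 1 <= r -> W1_Lp r y -> W1_Lp r z -> W1_Lp r (a *: y + z).
Proof.
move=> r1 [y1 y2] [z1 z2]; have r0 : 0 < r by exact: lt_le_trans r1.
split=> [|i]; first exact: (in_LpD oOm r1 (in_LpZ oOm a r0 y1) z1).
exact: (in_LpD oOm r1 (in_LpZ oOm a r0 (y2 i)) (z2 i)).
Qed.

Lemma W1normD r y z : 1 <= r -> W1_Lp r y -> W1_Lp r z ->
  (W1norm Om r (y + z)%R <= W1norm Om r y + W1norm Om r z)%E.
Proof.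
move=> r1 [[y1 _] y2] [[z1 _] z2]; rewrite /W1norm addeACA -big_split/=.
apply: leeD; first exact: (Lnorm_restrictD mu mOm r1 y1 z1).
apply: lee_sum => i _.
exact: (Lnorm_restrictD mu mOm r1 (y2 i).1 (z2 i).1).
Qed.

Lemma W1normZ r a y : 0 < r -> W1_Lp r y ->
  W1norm Om r (a *: y) = (`|a|%:E * W1norm Om r y)%E.
Proof.
move=> r0 [[y1 _] y2]; rewrite /W1norm ge0_muleDr ?Lnorm_ge0//; last first.
  by apply: sume_ge0 => i _; exact: Lnorm_ge0.
rewrite (Lnorm_restrictZ mu mOm a r0 y1) ge0_sume_distrr//; last first.
  by move=> i _; exact: Lnorm_ge0.
congr (_ + _)%E; apply: eq_bigr => i _.
exact: (Lnorm_restrictZ mu mOm a r0 (y2 i).1).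
Qed.

Lemma W1norm_ge0 r y : (0 <= W1norm Om r y)%E.
Proof. by rewrite adde_ge0 ?Lnorm_ge0// sume_ge0// => i _; exact: Lnorm_ge0. Qed.

Lemma W1norm_lty r y : W1_Lp r y -> (W1norm Om r y < +oo)%E.
Proof.
move=> [[_ y1] y2]; rewrite lte_add_pinfty//.
by apply: lte_sum_pinfty => i _; have [] := y2 i.
Qed.

Lemma W1normB_sym r y z : W1norm Om r (y - z) = W1norm Om r (z - y).
Proof.
rewrite /W1norm -(Lnorm_restrictN mu Om r (y - z).1); congr (_ + _)%E.
  by apply: eq_Lnorm_restrict => x _ /=; rewrite opprD opprK addrC.
apply: eq_bigr => i _; rewrite -(Lnorm_restrictN mu Om r ((y - z).2 i)).
by apply: eq_Lnorm_restrict => x _ /=; rewrite opprD opprK addrC.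
Qed.

Lemma test_fun_W1_Lp r phi : 0 < r -> test_fun Om phi -> W1_Lp r (sobolev_of phi).
Proof. by move=> r0 /(test_fun_in_Lp oOm bOm r0). Qed.

Lemma sobolev_of_lin a phi psi : test_fun Om phi -> test_fun Om psi ->
  sobolev_of (fun x => a * phi x + psi x) = a *: sobolev_of phi + sobolev_of psi.
Proof.
move=> tphi tpsi; congr pair; apply/funext => i.
exact: (derive_test_fun_lin a i tphi tpsi).
Qed.

Lemma conj_expP r : 1 < r -> [/\ 0 < conj_exp r, r^-1 + (conj_exp r)^-1 = 1,
  conj_exp (conj_exp r) = r & 1 < conj_exp r].
Proof.
move=> r1; have r10 : r - 1 != 0 by rewrite subr_eq0 gt_eqF.
have r0 : r != 0 by rewrite gt_eqF//; lra.
rewrite /conj_exp; split.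
- by rewrite divr_gt0//; lra.
- by field; rewrite r0 r10.
- have -> : r / (r - 1) - 1 = (r - 1)^-1 by field.
  by rewrite invrK divfK.
- by rewrite ltr_pdivlMr; lra.
Qed.

Lemma W1_lin r a y z : 1 < r -> W1 Om r y -> W1 Om r z -> W1 Om r (a *: y + z).
Proof.
move=> r1 Wy Wz; have [H1 H2] := W1_Lp_lin a (ltW r1) (W1_W1_Lp Wy) (W1_W1_Lp Wz).
split => // phi tphi i.
have [r'0 rr' _ _] := conj_expP r1; have r0 : 0 < r by lra.
have [y1 y2 yw] := Wy; have [z1 z2 zw] := Wz.
have [p1 p2] := test_fun_in_Lp oOm bOm r'0 tphi.
have I f g : in_Lp Om r f -> in_Lp Om (conj_exp r) g ->
    mu.-integrable Om (EFin \o (fun x => f x * g x)).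
  by move=> [mf Nf] [mg Ng]; exact: (integrable_mul_conjugate mOm r0 r'0 rr').
have L (f1 f2 g : 'rV[R]_d -> R) : in_Lp Om r f1 -> in_Lp Om r f2 -> in_Lp Om (conj_exp r) g ->
   \int[mu]_(x in Om) ((a * f1 x + f2 x) * g x) =
   a * (\int[mu]_(x in Om) (f1 x * g x)) + \int[mu]_(x in Om) (f2 x * g x).
  move=> h1 h2 h3; rewrite -RintegralZl//; last exact: I.
  rewrite -RintegralD//; last 2 first.
  - by apply: (integrableZl mOm a (I _ _ h1 h3)).
  - exact: I.
  by apply: eq_Rintegral => x _; rewrite mulrDl mulrA.
rewrite [LHS](L y.1 z.1 _ y1 z1 (p2 i)) yw// zw//.
by rewrite [in RHS](L (y.2 i) (z.2 i) _ (y2 i) (z2 i) p1) opprD mulrN.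
Qed.

Lemma W10_lin r a y z : 1 < r -> W10 Om r y -> W10 Om r z -> W10 Om r (a *: y + z).
Proof.
move=> r1 [Wy ay] [Wz az]; split; first exact: W1_lin.
move=> e e0; have r0 : 0 < r by lra.
(* The [+ 1] covers a = 0. *)
have e1 : 0 < e / 2 / (`|a| + 1) by rewrite !divr_gt0.
have e2 : 0 < e / 2 by rewrite divr_gt0.
have [phi tphi Hphi] := ay _ e1; have [psi tpsi Hpsi] := az _ e2.
exists (fun x => a * phi x + psi x); first exact: test_fun_lin.
rewrite sobolev_of_lin// opprD addrACA -scalerBr.
have LB u chi : W1 Om r u -> test_fun Om chi -> W1_Lp r (u - sobolev_of chi).
  move=> Wu tchi; rewrite addrC -scaleN1r.
  by apply: W1_Lp_lin; [exact: ltW|exact: test_fun_W1_Lp|exact: W1_W1_Lp].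
have Lay : W1_Lp r (a *: (y - sobolev_of phi)).
  rewrite -[a *: _]addr0; apply: W1_Lp_lin; [exact: ltW|exact: LB|].
  have L0 := W1_W1_Lp Wy.
  by have := W1_Lp_lin (-1) (ltW r1) L0 L0; rewrite scaleN1r addNr.
apply: le_lt_trans (W1normD (ltW r1) Lay (LB _ _ Wz tpsi)) _.
rewrite W1normZ//; last exact: LB.
move: Hphi Hpsi (W1norm_ge0 r (y - sobolev_of phi)) (W1norm_ge0 r (z - sobolev_of psi)).
case: (W1norm _ _ _) => [u| |]//; case: (W1norm _ _ _) => [w| |]//.
rewrite -EFinM -EFinD !lte_fin !lee_fin ltr_pdivlMr// => ue we u0 w0.
by nra.
Qed.

End W1_space.

(** * The embedding of W^{1,s}_0 into C_0 for s > d *)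

Section embedding.
Context {R : realType} {n : nat}.
Variables (Om : set 'rV[R]_n.+1) (s : R).
Hypotheses (oOm : open Om) (bOm : bounded_set Om) (ns : n.+1%:R < s).
Local Notation mu := (@lebesgue_rV R n.+1).
Local Notation N r f := ('N[mu]_r%:E[EFin \o (f \_ Om)])%E.
Local Notation D i f := ('D_(delta_mx ord0 i) f).
Implicit Types (y z v w : @sobolev_fun R n.+1) (phi psi g : 'rV[R]_n.+1 -> R) (a r : R).

Let s1 : 1 < s. Proof. by rewrite (le_lt_trans _ ns)// ler1n. Qed.
Let s0 : 0 < s. Proof. exact: lt_trans s1. Qed.

(** This is the passage to the limit for every approximation of accuracy 1/(k+1) below: of Sobolev
    functions by test functions, and of minimizers by measurable selections. *)
Lemma le_harmonicP (x y B : R) : (forall k : nat, x <= y + B * k.+1%:R^-1) -> x <= y.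
Proof.
move=> H; apply/ler_addgt0Pr => e e0.
have [B0|B0] := leP B 0.
  by apply: le_trans (H 0%N) _; rewrite invr1 mulr1 lerD2l (le_trans B0)// ltW.
have [k ke] := ltr_add_invr (divr_gt0 e0 B0).
rewrite add0r ltr_pdivlMr// mulrC in ke.
by apply: le_trans (H k) _; rewrite lerD2l ltW.
Qed.

Lemma test_fun_integral_le1 phi i : test_fun Om phi ->
  (W1norm Om s (sobolev_of phi) <= 1)%E ->
  (\int[mu]_x (`|D i phi x| `^ s)%:E <= 1)%E.
Proof.
move=> tphi phi1.
have -> : (\int[mu]_x (`|D i phi x| `^ s)%:E = \int[mu]_(x in Om) (`|D i phi x| `^ s)%:E)%E.
  apply: etrans _ (esym (integral_mkcond _ _)).
  apply: eq_integral => x _; rewrite patchE; case: ifPn => // /negP xOm.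
  rewrite (test_fun_derive0 i tphi) ?normr0 ?powR0 ?gt_eqF//.
  by move=> Omx; apply: xOm; rewrite inE.
rewrite -poweR_Lnorm_restrict ?gt_eqF// -(poweR1r s).
have Ni : (N s (D i phi) <= 1)%E.
  apply: le_trans phi1; rewrite /W1norm (bigD1 i)//= addeCA leeDl//.
  by rewrite adde_ge0 ?Lnorm_ge0// sume_ge0// => j _; exact: Lnorm_ge0.
apply: (gt0_ler_poweR (ltW s0)) => //.
  by rewrite in_itv/= leey Lnorm_ge0.
by rewrite in_itv/= leey lee_fin ler01.
Qed.

Lemma test_fun_sup_bound1 : exists2 C : R, 0 <= C & forall phi x,
  test_fun Om phi -> (W1norm Om s (sobolev_of phi) <= 1)%E -> `|phi x| <= C.
Proof.
have [M M0 OmM] := bounded_set_ball bOm.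
pose K := n.+1%:R * ((2 * M) `^ (1 - n%:R / (s - 1)) / (1 - n%:R / (s - 1))).
(* Each of the [n.+1] derivative integrals is at most 1, and [K] comes from the Young weight; the
   maximum with 0 gives the sign at once. *)
exists (Num.max (n.+1%:R + K) 0); first by rewrite le_max lexx orbT.
move=> phi x tphi phi1; rewrite le_max; apply/orP; left.
have supp (y : 'rV[R]_n.+1) : phi y != 0 -> `|y ord0 ord0| < M.
  move=> /(test_funE tphi)/OmM[_ /(_ ord0 ord0)].
  by rewrite -ball_normE /ball_/= mxE sub0r normrN.
have [/(_ 1%N) Cphi _ _] := tphi.
have := Ck1_sup_bound x ns M0 Cphi supp; rewrite -/K -lee_fin => /le_trans; apply.
rewrite EFinD leeD2r// ge0_integral_sum//.
- rewrite (_ : n.+1%:R%:E = \sum_(i < n.+1) 1)%E; last first.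
    by rewrite sumEFin sumr_const card_ord.
  by apply: lee_sum => i _; exact: test_fun_integral_le1.
- move=> i; apply/measurable_EFinP; apply: (measurableT_comp (measurable_powR _)).
  apply: measurableT_comp => //; apply: continuous_measurable_rV.
  by have [_ /(_ i)[_ []]] := Cphi.
Qed.

Lemma test_fun_sup_bound : exists2 C : R, 0 <= C & forall phi x,
  test_fun Om phi -> (`|phi x|%:E <= C%:E * W1norm Om s (sobolev_of phi))%E.
Proof.
have [C C0 HC] := test_fun_sup_bound1; exists C => // phi x tphi.
have Lphi := test_fun_W1_Lp oOm bOm s0 tphi.
have := W1norm_lty Lphi; have := W1norm_ge0 Om s (sobolev_of phi).
case EW : (W1norm Om s (sobolev_of phi)) => [w||]// + _; rewrite lee_fin => w0.
rewrite -EFinM lee_fin; apply/ler_addgt0Pr => e e0.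
have C1 : 0 < C + 1 by rewrite ltr_wpDl.
(* Scaling by slightly less than 1 / w remains meaningful when w = 0; the loss is C e / (C + 1) <
   e. *)
pose l := (w + e / (C + 1))^-1.
have l0' : 0 < w + e / (C + 1) by rewrite ltr_wpDl// divr_gt0.
have l0 : 0 < l by rewrite invr_gt0.
(* The multiple l phi is written as (l - 1) phi + phi to fit the closure lemma. *)
have := HC _ x (test_fun_lin (l - 1) tphi tphi).
rewrite (sobolev_of_lin _ tphi tphi) -[X in _ + X]scale1r -scalerDl subrK.
rewrite (W1normZ oOm)// EW -EFinM lee_fin gtr0_norm// => H.
have {}H : `|(l - 1) * phi x + phi x| <= C.
  apply: H; rewrite mulrC ler_pdivrMr// mul1r lerDl divr_ge0// ltW//.
have : l * `|phi x| <= C.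
  by rewrite -[l]gtr0_norm// -normrM; apply: le_trans H; rewrite mulrBl mul1r subrK.
rewrite mulrC ler_pdivrMr// mulrDr => /le_trans; apply; rewrite lerD2l.
by rewrite mulrA ler_pdivrMr// mulrC ler_wpM2l ?ltW// ltrDl.
Qed.

End embedding.

Section continuous_representative.
Context {R : realType} {n : nat}.
Variables (Om : set 'rV[R]_n.+1) (s : R).
Hypotheses (oOm : open Om) (bOm : bounded_set Om) (ns : n.+1%:R < s).
Local Notation mu := (@lebesgue_rV R n.+1).
Local Notation N r f := ('N[mu]_r%:E[EFin \o (f \_ Om)])%E.
Implicit Types (y z v w : @sobolev_fun R n.+1) (phi psi g : 'rV[R]_n.+1 -> R) (a r : R).

Let mOm : measurable Om. Proof. exact: open_measurable_rV. Qed.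
Let s1 : 1 < s. Proof. by rewrite (le_lt_trans _ ns)// ler1n. Qed.
Let s0 : 0 < s. Proof. exact: lt_trans s1. Qed.

(** Test functions approximating v are uniformly Cauchy by [test_fun_sup_bound]. Their uniform limit
    is continuous and vanishes off [Om]; as [Om] has finite measure it is also the limit in L^s,
    hence equals v almost everywhere. The constant is chosen before v, which makes the embedding
    bounded. *)
Lemma W10_continuous_representative : exists2 C : R, 0 <= C &
  forall v, W10 Om s v -> exists g,
    [/\ continuous g, forall x, ~ Om x -> g x = 0,
        {ae mu, forall x, Om x -> g x = v.1 x} &
        forall x, (`|g x|%:E <= C%:E * W1norm Om s v)%E].
Proof.
have [C C0 HC] := test_fun_sup_bound oOm bOm ns; exists C => // v [Wv av].
have k0 k : 0 < k.+1%:R^-1 :> R by rewrite invr_gt0.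
have /choice[phi Hphi] k : exists phi, test_fun Om phi /\
    (W1norm Om s (v - sobolev_of phi)%R < (k.+1%:R^-1)%:E)%E.
  by have [phi tphi Hphi] := av _ (k0 k); exists phi.
have tphi k := (Hphi k).1; have vphi k := (Hphi k).2.
have Lv := W1_W1_Lp Wv.
have Lphi k : W1_Lp Om s (sobolev_of (phi k)) by exact: test_fun_W1_Lp.
have LB y z : W1_Lp Om s y -> W1_Lp Om s z -> W1_Lp Om s (y - z).
  by move=> Ly Lz; rewrite addrC -scaleN1r; exact: (W1_Lp_lin oOm _ (ltW s1)).
have cauchy k m x : `|phi k x - phi m x| <= C * k.+1%:R^-1 + C * m.+1%:R^-1.
  have := HC _ x (test_fun_lin (-1) (tphi m) (tphi k)).
  rewrite (sobolev_of_lin _ (tphi m) (tphi k)) scaleN1r mulN1r addrC.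
  rewrite -lee_fin => /le_trans; apply.
  rewrite -mulrDr EFinM; apply: lee_wpmul2l; first by rewrite lee_fin.
  have -> : - sobolev_of (phi m) + sobolev_of (phi k) =
      (sobolev_of (phi k) - v) + (v - sobolev_of (phi m)).
    by rewrite addrA subrK addrC.
  apply: le_trans (W1normD oOm (ltW s1) _ _) _; [exact: LB|exact: LB|].
  by rewrite EFinD; apply: leeD; [rewrite W1normB_sym|]; exact: ltW.
(* Taking a supremum instead of the limit of [phi k x] makes the uniform estimate
   [gphi] immediate. *)
pose A x := [set phi k x - C * k.+1%:R^-1 | k in [set: nat]].
pose g x := sup (A x).
have A0 x : A x !=set0 by exists (phi 0%N x - C * 1%:R^-1); exists 0%N.
have ubA x m : ubound (A x) (phi m x + C * m.+1%:R^-1).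
  move=> _ [k _ <-]; have := cauchy k m x; rewrite ler_norml => /andP[_].
  by move: (C * _) (C * _) => a b; lra.
have gphi x k : `|g x - phi k x| <= C * k.+1%:R^-1.
  rewrite ler_norml; apply/andP; split.
    have : phi k x - C * k.+1%:R^-1 <= g x.
      by apply: ub_le_sup; [exists (phi 0%N x + C * 1%:R^-1); exact: (ubA x 0%N)|exists k].
    by move: (C * _) => a; lra.
  have : g x <= phi k x + C * k.+1%:R^-1 by exact: (ge_sup (A0 x) (ubA x k)).
  by move: (C * _) => a; lra.
have cg : continuous g.
  move=> x; suff : forall e : R, 0 < e -> \forall t \near x, `|g x - g t| <= e by move/cvgrPdist_le.
  move=> e e0.
  (* Two uniform errors C/(k+1) and the oscillation 1/(k+1) of [phi k] near x must add up to less
     than e. *)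
  have C1 : 0 < 2 * C + 1 by rewrite ltr_wpDl// mulr_ge0.
  have [k ke] := ltr_add_invr (divr_gt0 e0 C1).
  rewrite add0r ltr_pdivlMr// mulrC in ke.
  rewrite mulrDl mul1r -mulrA in ke.
  have ek : 0 < k.+1%:R^-1 :> R by [].
  have cphi : continuous (phi k) by have [/(_ 0%N)[]] := tphi k.
  have /cvgrPdist_lt/(_ _ ek) := cphi x; apply: filterS => t.
  have := gphi x k; have := gphi t k.
  move: ke; move: (C * _) => p; move: (k.+1%:R^-1) => u ke.
  rewrite !ler_norml ltr_norml => /andP[? ?] /andP[? ?] /andP[? ?].
  by apply/andP; split; lra.
exists g; split => //.
- move=> x nOmx; apply/eqP; rewrite -normr_le0.
  apply: (@le_harmonicP _ _ _ C) => k; rewrite add0r.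
  have := gphi x k; suff -> : phi k x = 0 by rewrite subr0.
  by apply/eqP/negbNE/negP => /(test_funE (tphi k)).
- have mg : measurable_fun Om g.
    by apply: measurable_funTS; exact: continuous_measurable_rV.
  have mv : measurable_fun Om v.1 by have [[]] := Lv.
  pose B (x : 'rV[R]_n.+1) : R := g x + -1 * v.1 x.
  have mB : measurable_fun Om B.
    by apply: measurable_funD => //; exact: measurable_funM.
  suff /(Lnorm_restrict_eq0 mOm s0 mB) : N s B = 0%E.
    by apply: filterS => x H Omx; apply/eqP; rewrite -subr_eq0 -mulN1r -[_ + _]/(B x) H.
  have muOm := lebesgue_bounded_lty oOm bOm.
  have := poweR_lty s^-1 muOm; have := poweR_ge0 (mu Om) s^-1.
  case EV : (mu Om `^ s^-1)%E => [V||]// V0 _; rewrite lee_fin in V0.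
  have H k : (N s B <= ((1 + C * V) * k.+1%:R^-1)%:E)%E.
    have mphi : measurable_fun Om (phi k) by have [[]] := Lphi k.
    have mgp : measurable_fun Om (fun x => g x - phi k x) by exact: measurable_funB.
    have mpv : measurable_fun Om (fun x => phi k x - v.1 x) by exact: measurable_funB.
    have -> : B = (fun x => (g x - phi k x) + (phi k x - v.1 x)).
      by apply/funext => x; rewrite /B mulN1r addrA subrK.
    apply: le_trans (Lnorm_restrictD mu mOm (ltW s1) mgp mpv) _.
    rewrite addeC mulrDl mul1r EFinD; apply: leeD.
      apply: le_trans (ltW (vphi k)); rewrite W1normB_sym /W1norm.
      rewrite [X in (X <= _)%E](_ : _ = N s (sobolev_of (phi k) - v)%R.1)//.
      by rewrite leeDl// sume_ge0// => i _; exact: Lnorm_ge0.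
    apply: le_trans (Lnorm_restrict_cst_le mu mOm s0 _ mgp (fun x _ => gphi x k)) _.
      by rewrite mulr_ge0// ltW.
    by rewrite EV -EFinM lee_fin mulrAC.
  apply/eqP; rewrite eq_le Lnorm_ge0 andbT.
  move: H; have := Lnorm_ge0 mu s%:E (EFin \o (B \_ Om)).
  case: ('N[_]__[_])%E => [t||]// _ H; last by have := H 0%N.
  rewrite lee_fin; apply: (@le_harmonicP _ _ _ (1 + C * V)) => k.
  by rewrite add0r -lee_fin.
- move=> x; have := W1norm_lty Lv; have := W1norm_ge0 Om s v.
  case EW : (W1norm Om s v) => [w||]// _ _; rewrite -EFinM lee_fin.
  apply: (@le_harmonicP _ _ _ (C + C)) => k; rewrite mulrDl addrA.
  have -> : g x = phi k x + (g x - phi k x) by rewrite addrC subrK.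
  apply: le_trans (ler_normD _ _) _; apply: lerD => //.
  rewrite -mulrDr -lee_fin; apply: le_trans (HC _ x (tphi k)) _.
  rewrite EFinM; apply: lee_wpmul2l; first by rewrite lee_fin.
  have -> : sobolev_of (phi k) = v + (sobolev_of (phi k) - v) by rewrite addrC subrK.
  apply: le_trans (W1normD oOm (ltW s1) Lv _) _; first exact: LB.
  by rewrite EW EFinD leeD2l// W1normB_sym ltW.
Qed.

(** A difference at a point of the open set would persist on a ball, which has positive measure.
    This makes the representative chosen by [sobolev_embedding] unique on [closure Om]. *)
Lemma ae_eq_continuous_closure (g h : 'rV[R]_n.+1 -> R) :
  {within closure Om, continuous g} -> {within closure Om, continuous h} ->
  (forall x, (closure Om `\` Om) x -> g x = h x) ->
  {ae mu, forall x, Om x -> g x = h x} ->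
  forall x, closure Om x -> g x = h x.
Proof.
move=> cg ch bd aegh x clx.
have [Omx|nOmx] := pselect (Om x); last exact: bd.
have cont (f : 'rV[R]_n.+1 -> R) : {within closure Om, continuous f} -> {for x, continuous f}.
  move=> cf; have : {within Om, continuous f}.
    exact: (continuous_subspaceW (@subset_closure _ Om) cf).
  by rewrite continuous_open_subspace// => /(_ x); apply; rewrite inE.
apply/eqP/negbNE/negP => gh.
have c : {for x, continuous (fun t => `|g t - h t|)}.
  by apply: continuous_comp; [apply: continuousB; exact: cont|exact: norm_continuous].
have gh0 : 0 < `|g x - h x| by rewrite normr_gt0 subr_eq0.
have nb : nbhs x ([set t | `| `|g x - h x| - `|g t - h t| | < `|g x - h x|] `&` Om).
  apply: filterI; last exact: open_nbhs_nbhs (conj oOm Omx).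
  by move/cvgrPdist_lt : c; exact.
have /nbhs_ballP[e /= e0 eS] := nb.
have [M [mM M0 sM]] := aegh.
have : (mu (ball x e) <= mu M)%E.
  apply: le_measure; rewrite ?inE//; first by apply: open_measurable_rV; exact: ball_open.
  move=> t /eS[/= t1 Omt]; apply: sM => /= /(_ Omt) E.
  by move: t1; rewrite E subrr normr0 subr0 normr_id ltxx.
by rewrite M0 lebesgue_rV_ball// lee_fin leNgt exprn_gt0// mulr_gt0.
Qed.

(** The property by which [sobolev_embedding] selects its value. *)
Definition is_embedding v g := [/\ {within closure Om, continuous g},
  forall x, (closure Om `\` Om) x -> g x = 0 &
  {ae mu, forall x, Om x -> g x = v.1 x}].

Lemma is_embedding_lin a v w g h : is_embedding v g -> is_embedding w h ->
  is_embedding (a *: v + w) (fun x => a * g x + h x).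
Proof.
move=> [cg bg ag] [ch bh ah]; split.
- move=> x; apply: (@continuousD _ _ (subspace (closure Om)) (fun x => a * g x) h); last exact: ch.
  by apply: (@continuousM _ (subspace (closure Om)) (cst a) g); [exact: cst_continuous|exact: cg].
- by move=> x bx; rewrite bg// bh// mulr0 addr0.
- by move: ag ah; apply: filterS2 => x gx hx Omx; rewrite gx// hx.
Qed.

Lemma is_embedding_uniq v g h : is_embedding v g -> is_embedding v h ->
  forall x, closure Om x -> g x = h x.
Proof.
move=> [cg bg ag] [ch bh ah]; apply: ae_eq_continuous_closure => //.
- by move=> x bx; rewrite bg// bh.
- by move: ag ah; apply: filterS2 => x gx hx Omx; rewrite gx// hx.
Qed.

(** For s above the dimension the default value of [xget] never occurs. *)
Lemma sobolev_embeddingP v : W10 Om s v -> is_embedding v (sobolev_embedding Om v).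
Proof.
move=> Wv; have [C _ /(_ v Wv)[g [cg g0 ag _]]] := W10_continuous_representative.
have H : is_embedding v g.
  split => //; first exact: continuous_subspaceT.
  by move=> x [_ /g0].
exact: (xgetPex (cst 0) (ex_intro (is_embedding v) g H)).
Qed.

(** Restricted to [closure Om] because the chosen representative is arbitrary elsewhere. *)
Lemma sobolev_embedding_lin a v w x : W10 Om s v -> W10 Om s w -> closure Om x ->
  sobolev_embedding Om (a *: v + w) x =
  a * sobolev_embedding Om v x + sobolev_embedding Om w x.
Proof.
move=> Wv Ww clx.
have H1 := sobolev_embeddingP (W10_lin oOm bOm a s1 Wv Ww).
have H2 := is_embedding_lin a (sobolev_embeddingP Wv) (sobolev_embeddingP Ww).
exact: (is_embedding_uniq H1 H2).
Qed.

Lemma sobolev_embedding_bound : exists2 C : R, 0 <= C & forall v x,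
  W10 Om s v -> closure Om x ->
  (`|sobolev_embedding Om v x|%:E <= C%:E * W1norm Om s v)%E.
Proof.
have [C C0 HC] := W10_continuous_representative; exists C => // v x Wv clx.
have [g [cg g0 ag gC]] := HC v Wv.
rewrite (@is_embedding_uniq v _ g (sobolev_embeddingP Wv))//.
split => //; first exact: continuous_subspaceT.
by move=> u [_ /g0].
Qed.

End continuous_representative.

(** * Charges and their integrals *)

Section bounded_integrals.
Context d (T : measurableType d) {R : realType}.
Implicit Types (X : set T) (f g : T -> R) (m : {measure set T -> \bar R}).

(** A class that contains the continuous functions on compact sets, is integrable for finite
    measures, and is stable under composition with the measurable selections, which need not be
    continuous. *)
Definition bounded_measurable X f :=
  measurable_fun X f /\ exists B : R, forall x, X x -> `|f x| <= B.

Lemma bounded_measurable_lin a X f g : bounded_measurable X f ->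
  bounded_measurable X g -> bounded_measurable X (fun x => a * f x + g x).
Proof.
move=> [mf [B fB]] [mg [C gC]]; split.
  by apply: measurable_funD => //; exact: measurable_funM.
exists (`|a| * B + C) => x Xx; apply: le_trans (ler_normD _ _) _.
by rewrite normrM lerD ?gC// ler_wpM2l// fB.
Qed.

Lemma bounded_measurable_integrable m X f : measurable X -> (m X < +oo)%E ->
  bounded_measurable X f -> m.-integrable X (EFin \o f).
Proof.
move=> mX mXoo [mf [B fB]]; apply: measurable_bounded_integrable => //.
exists B; split; first exact: num_real.
by move=> t Bt x Xx /=; rewrite (le_trans (fB _ Xx))// ltW.
Qed.

Lemma integral_mscale (k : {nonneg R}) m X (f : T -> \bar R) : measurable X ->
  m.-integrable X f ->
  (\int[mscale k m]_(x in X) f x = k%:num%:E * \int[m]_(x in X) f x)%E.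
Proof.
move=> mX If; have mf := measurable_int _ If.
rewrite [LHS]integralE [X in (_ * X)%E]integralE muleBr//; last first.
  exact: (integrable_add_def mX If).
by congr (_ - _)%E; apply: ge0_integral_mscale => //;
  [exact: measurable_funepos|exact: measurable_funeneg].
Qed.

Lemma Rintegral_lin m a X f g : measurable X -> (m X < +oo)%E ->
  bounded_measurable X f -> bounded_measurable X g ->
  \int[m]_(x in X) (a * f x + g x) =
  a * (\int[m]_(x in X) f x) + \int[m]_(x in X) g x.
Proof.
move=> mX mXoo bf bg.
have If := bounded_measurable_integrable mX mXoo bf.
have Ig := bounded_measurable_integrable mX mXoo bg.
rewrite RintegralD//; first by rewrite RintegralZl.
exact: (integrableZl mX a If).
Qed.

Lemma Rintegral_norm_le m X f B : measurable X -> (m X < +oo)%E ->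
  measurable_fun X f -> (forall x, X x -> `|f x| <= B) ->
  `|\int[m]_(x in X) f x| <= B * fine (m X).
Proof.
move=> mX mXoo mf fB.
have bf : bounded_measurable X f by split => //; exists B.
have If := bounded_measurable_integrable mX mXoo bf.
apply: le_trans (le_normr_Rintegral mX If) _.
have -> : B * fine (m X) = \int[m]_(x in X) (cst B x) by rewrite Rintegral_cst.
apply: le_Rintegral => //.
- exact: integrable_norm If.
- by apply: bounded_measurable_integrable => //; split => //; exists `|B|.
Qed.

End bounded_integrals.

Section charge_integral.
Context d (T : measurableType d) {R : realType}.
Variables (X : set T) (mX : measurable X).
Implicit Types (f g : T -> R) (u v : {charge set T -> \bar R})
  (m : {measure set T -> \bar R}).

Lemma charge_decomposition u : exists p q : {measure set T -> \bar R},
  [/\ (p setT < +oo)%E, (q setT < +oo)%E,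
      forall A, measurable A -> u A = (p A - q A)%E &
      forall f, charge_integral u X f =
        \int[p]_(x in X) f x - \int[q]_(x in X) f x].
Proof.
exists (jordan_pos (hahnP u)), (jordan_neg (hahnP u)); split => [| |A mA|//].
- by rewrite -ge0_fin_numE//; exact: fin_num_measure.
- by rewrite -ge0_fin_numE//; exact: fin_num_measure.
- by rewrite (jordan_decomp (hahnP u) mA) /cadd/= cscaleN1.
Qed.

Lemma finite_measure_lty m A : (m setT < +oo)%E -> measurable A -> (m A < +oo)%E.
Proof. by move=> moo mA; apply: le_lt_trans moo; apply: le_measure; rewrite ?inE. Qed.

Lemma finite_measure_fin_num m A : (m setT < +oo)%E -> measurable A -> m A \is a fin_num.
Proof. by move=> moo mA; rewrite ge0_fin_numE//; exact: finite_measure_lty. Qed.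

(* A charge integral may be computed from any decomposition of the charge as a
   difference of finite measures, not only from the Jordan one. *)
Lemma charge_integral_diff u m1 m2 f : (m1 setT < +oo)%E -> (m2 setT < +oo)%E ->
  (forall A, measurable A -> u A = (m1 A - m2 A)%E) -> bounded_measurable X f ->
  charge_integral u X f = \int[m1]_(x in X) f x - \int[m2]_(x in X) f x.
Proof.
move=> m1oo m2oo um bf; have [p [q [poo qoo upq ->]]] := charge_decomposition u.
have fin := finite_measure_fin_num.
have pfin A : measurable A -> p A \is a fin_num by exact: fin.
have qfin A : measurable A -> q A \is a fin_num by exact: fin.
have I m : m X \is a fin_num -> m.-integrable X (EFin \o f).
  move=> mfin; apply: bounded_measurable_integrable => //.
  by move: mfin; rewrite ge0_fin_numE.
have E A : measurable A -> measure_add p m2 A = measure_add q m1 A.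
  move=> mA; rewrite !measure_addE; have := upq A mA; rewrite um//.
  move: (pfin _ mA) (qfin _ mA) (fin _ _ m1oo mA) (fin _ _ m2oo mA).
  case: (p A) => // a _; case: (q A) => // b _.
  case: (m1 A) => // a' _; case: (m2 A) => // b' _.
  by rewrite -!EFinD => -[] ?; congr EFin; lra.
(* The identity p - q = m1 - m2 becomes p + m2 = q + m1, an equality of measures, and can then be
   integrated. *)
have : (\int[measure_add p m2]_(x in X) (f x)%:E =
        \int[measure_add q m1]_(x in X) (f x)%:E)%E.
  by apply: eq_measure_integral => A mA _; exact: E.
have := integral_measure_add mX (I p (pfin _ mX)) (I m2 (fin _ _ m2oo mX)).
have := integral_measure_add mX (I q (qfin _ mX)) (I m1 (fin _ _ m1oo mX)).
move=> /= -> ->.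
have Ifin m : m X \is a fin_num -> (\int[m]_(x in X) (f x)%:E)%E \is a fin_num.
  by move=> /I; exact: integrable_fin_num.
move: (Ifin p (pfin _ mX)) (Ifin q (qfin _ mX)) (Ifin m1 (fin _ _ m1oo mX))
  (Ifin m2 (fin _ _ m2oo mX)).
rewrite /Rintegral.
case: (\int[p]_(x in X) (f x)%:E)%E => // a _.
case: (\int[q]_(x in X) (f x)%:E)%E => // b _.
case: (\int[m1]_(x in X) (f x)%:E)%E => // a' _.
case: (\int[m2]_(x in X) (f x)%:E)%E => // b' _ /=.
by rewrite -!EFinD => -[]; lra.
Qed.

Lemma charge_integral_lin u a f g : bounded_measurable X f -> bounded_measurable X g ->
  charge_integral u X (fun x => a * f x + g x) =
  a * charge_integral u X f + charge_integral u X g.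
Proof.
move=> bf bg; have [p [q [poo qoo _ E]]] := charge_decomposition u.
by rewrite !E !Rintegral_lin//; [ring|exact: finite_measure_lty..].
Qed.

Lemma eq_charge_integral u f g : {in X, f =1 g} ->
  charge_integral u X f = charge_integral u X g.
Proof. by move=> fg; congr (_ - _); exact: eq_Rintegral. Qed.

Lemma charge_integral_norm_le u : exists2 K : R, 0 <= K & forall f B,
  measurable_fun X f -> (forall x, X x -> `|f x| <= B) ->
  `|charge_integral u X f| <= B * K.
Proof.
have [p [q [poo qoo _ E]]] := charge_decomposition u.
exists (fine (p X) + fine (q X)) => [|f B mf fB].
  by rewrite addr_ge0// fine_ge0.
rewrite E mulrDr; apply: le_trans (ler_normB _ _) _.
by apply: lerD; apply: Rintegral_norm_le => //; exact: finite_measure_lty.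
Qed.

Lemma charge_integral_cadd u v f : bounded_measurable X f ->
  charge_integral (cadd u v) X f = charge_integral u X f + charge_integral v X f.
Proof.
move=> bf.
have [p [q [poo qoo uE uI]]] := charge_decomposition u.
have [p' [q' [poo' qoo' vE vI]]] := charge_decomposition v.
have fin m1 m2 : (m1 setT < +oo)%E -> (m2 setT < +oo)%E ->
    (measure_add m1 m2 setT < +oo)%E.
  by move=> ? ?; rewrite measure_addE lte_add_pinfty.
rewrite (@charge_integral_diff _ (measure_add p p') (measure_add q q'))//.
- have mf : measurable_fun X (EFin \o f) by apply/measurable_EFinP; case: bf.
  have add m1 m2 : (m1 setT < +oo)%E -> (m2 setT < +oo)%E ->
      \int[measure_add m1 m2]_(x in X) f x =
      \int[m1]_(x in X) f x + \int[m2]_(x in X) f x.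
    move=> m1oo m2oo.
    have I1 := bounded_measurable_integrable mX (finite_measure_lty m1oo mX) bf.
    have I2 := bounded_measurable_integrable mX (finite_measure_lty m2oo mX) bf.
    rewrite /Rintegral (integral_measure_add mX I1 I2) fineD//.
    - exact: (integrable_fin_num mX I1).
    - exact: (integrable_fin_num mX I2).
  by rewrite !add// uI vI; ring.
- exact: fin.
- exact: fin.
- move=> A mA.
  transitivity ((p A + p' A) - (q A + q' A))%E; last by rewrite -!measure_addE.
  rewrite -[LHS]/(u A + v A)%E uE// vE//.
  move: (finite_measure_fin_num poo mA) (finite_measure_fin_num qoo mA)
    (finite_measure_fin_num poo' mA) (finite_measure_fin_num qoo' mA).
  case: (p A) => // a; case: (q A) => // b.
  case: (p' A) => // a'; case: (q' A) => // b' _ _ _ _.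
  by rewrite -!EFinD; congr EFin; ring.
Qed.

Lemma charge_integral_copp u f : bounded_measurable X f ->
  charge_integral (copp u) X f = - charge_integral u X f.
Proof.
move=> bf; have [p [q [poo qoo uE uI]]] := charge_decomposition u.
rewrite (@charge_integral_diff _ q p)//.
- by rewrite uI opprB.
- move=> A mA; rewrite -[LHS]/(- u A)%E uE//.
  by rewrite fin_num_oppeB ?finite_measure_fin_num// addeC.
Qed.

Lemma charge_integral_cscale u (a : R) f : 0 <= a -> bounded_measurable X f ->
  charge_integral (cscale a u) X f = a * charge_integral u X f.
Proof.
move=> a0 bf; pose na := NngNum a0.
have [p [q [poo qoo uE uI]]] := charge_decomposition u.
have scoo m : (m setT < +oo)%E -> (mscale na m setT < +oo)%E.
  by move=> moo; rewrite /mscale/= lte_mul_pinfty.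
have scE m : (m setT < +oo)%E ->
    \int[mscale na m]_(x in X) f x = a * \int[m]_(x in X) f x.
  move=> moo; have If := bounded_measurable_integrable mX (finite_measure_lty moo mX) bf.
  by rewrite /Rintegral integral_mscale// fineM// (integrable_fin_num mX If).
rewrite (@charge_integral_diff _ (mscale na p) (mscale na q))//.
- by rewrite !scE// uI mulrBr.
- exact: scoo.
- exact: scoo.
- move=> A mA; rewrite -[LHS]/(a%:E * u A)%E uE// /mscale/=.
  by rewrite muleBr// fin_num_adde_defr// finite_measure_fin_num.
Qed.

(** Both Jordan parts are, up to sign, values of v on Hahn sets, hence at most a times a bound for
    |u|; [K] is crude, and only the linear dependence on a matters. The charge v is compared with a
    u setwise because it will be a sum such as [cadd ut (copp ubar)]. *)
Lemma total_variation_cscale_le u : exists2 K : R, 0 <= K &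
  forall a (v : {charge set T -> \bar R}),
  0 <= a -> (forall A, measurable A -> v A = (a%:E * u A)%E) ->
  (Defs.total_variation v <= (a * K)%:E)%E.
Proof.
have [p [q [poo qoo uE _]]] := charge_decomposition u.
pose K := fine (p setT) + fine (q setT).
have uK A : measurable A -> exists2 t : R, u A = t%:E & `|t| <= K.
  move=> mA; rewrite uE//.
  have pA : (p A <= p setT)%E by apply: le_measure; rewrite ?inE.
  have qA : (q A <= q setT)%E by apply: le_measure; rewrite ?inE.
  have p0 : (0 <= p A)%E by [].
  have q0 : (0 <= q A)%E by [].
  move: pA qA p0 q0
    (finite_measure_fin_num poo (@measurableT _ T))
    (finite_measure_fin_num qoo (@measurableT _ T)).
  rewrite /K; case: (p setT) => // a; case: (q setT) => // b.
  case: (p A) => // a'; case: (q A) => // b'; rewrite !lee_fin => ? ? ? ? _ _.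
  by exists (a' - b') => //=; rewrite ler_norml; apply/andP; split; lra.
exists (K + K).
  have [t _ tK] := uK set0 measurable0.
  by apply: addr_ge0; apply: le_trans tK.
move=> a v a0 va.
rewrite /Defs.total_variation /charge_variation/= jordan_posE jordan_negE.
rewrite cjordan_posE cjordan_negE /crestr0 !mem_set// /crestr !setTI.
have [[mP _] [mN _] _ _] := hahnP v.
rewrite !va//; have [t -> tK] := uK _ mP; have [t' -> t'K] := uK _ mN.
rewrite -EFinM -EFinM -EFinN -EFinD lee_fin mulrDr -mulrN; apply: lerD.
  by rewrite ler_wpM2l// (le_trans _ tK)// ler_norm.
by rewrite ler_wpM2l// (le_trans _ t'K)// -normrN ler_norm.
Qed.

End charge_integral.

(** * Borel measurability on products and compact sets *)

Section compact_continuous.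
Context {R : realType}.

(** The product carries the product sigma-algebra, so open sets are not measurable by definition.
    Concatenation [row_mx] is measurable coordinatewise and moves the question to R^(n+m). *)
Lemma open_measurable_rV_prod n m (U : set ('rV[R]_n * 'rV[R]_m)) :
  open U -> measurable U.
Proof.
move=> oU; pose f (z : 'rV[R]_n * 'rV[R]_m) : 'rV[R]_(n + m) := row_mx z.1 z.2.
pose g (w : 'rV[R]_(n + m)) : 'rV[R]_n * 'rV[R]_m := (lsubmx w, rsubmx w).
have mf : measurable_fun setT f.
  apply: measurable_rV_coord => j; have := fintype.splitK j.
  case: (fintype.split j) => k <- /=.
    rewrite [X in measurable_fun _ X](_ : _ = (fun z : 'rV[R]_n => z ord0 k) \o (@fst 'rV[R]_n 'rV[R]_m)).
      apply: measurableT_comp; last exact: measurable_fst.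
      exact: (continuous_measurable_rV (@coord_continuous _ _ _ _ _)).
    by apply/funext => z /=; rewrite /f row_mxEl.
  rewrite [X in measurable_fun _ X](_ : _ = (fun z : 'rV[R]_m => z ord0 k) \o (@snd 'rV[R]_n 'rV[R]_m)).
    apply: measurableT_comp; last exact: measurable_snd.
    exact: (continuous_measurable_rV (@coord_continuous _ _ _ _ _)).
  by apply/funext => z /=; rewrite /f row_mxEr.
have cg : continuous g.
  move=> w A /nbhs_ballP[e /= e0 eA]; apply/nbhs_ballP; exists e => // w' [_ ww'].
  by apply: eA; split; split => // i j; rewrite !mxE; exact: ww'.
rewrite (_ : U = f @^-1` (g @^-1` U)); last first.
  by apply/seteqP; split => -[x y]; rewrite /f /g /= row_mxKl row_mxKr.
rewrite -[X in measurable X]setTI; apply: mf => //.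
by apply: open_measurable_rV; apply: open_comp.
Qed.

Lemma within_continuous_measurable_rV_prod n m (D : set ('rV[R]_n * 'rV[R]_m))
    (f : 'rV[R]_n * 'rV[R]_m -> R) :
  measurable D -> {within D, continuous f} -> measurable_fun D f.
Proof.
move=> mD cf; apply: (measurability _ (measurable_realfun.RGenOpens.measurableE R)).
move=> _ [_ [a [b ->] <-]].
have [V oV ->] := within_continuous_preimage cf (@interval_open _ (BRight a) (BLeft b) isT isT).
by apply: measurableI => //; exact: open_measurable_rV_prod.
Qed.

Lemma compact_measurable_rV n (K : set 'rV[R]_n) : compact K -> measurable K.
Proof.
move=> cK; rewrite -(setCK K); apply: measurableC; apply: open_measurable_rV.
by apply: closed_openC; apply: compact_closed => //; exact: norm_hausdorff.
Qed.

Lemma within_continuous_compact_bounded (T : topologicalType) (K : set T) (f : T -> R) :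
  compact K -> {within K, continuous f} -> exists B : R, forall x, K x -> `|f x| <= B.
Proof.
move=> cK cf; have [->|/set0P K0] := eqVneq K set0; first by exists 0.
have cnf : {within K, continuous (fun x => `|f x|)}.
  by move=> x; apply: continuous_comp; [exact: cf|exact: norm_continuous].
have [c _ Hc] := compact_EVT_max K0 cK cnf.
by exists `|f c| => x Kx; apply: Hc; rewrite inE.
Qed.

Lemma within_continuous_bounded_measurable n (K : set 'rV[R]_n) (f : 'rV[R]_n -> R) :
  compact K -> {within K, continuous f} -> bounded_measurable K f.
Proof.
move=> cK cf; split; last exact: within_continuous_compact_bounded.
by apply: within_continuous_measurable_rV => //; exact: compact_measurable_rV.
Qed.

End compact_continuous.

Section pushforward_finite.
Context d d' (T : measurableType d) (T' : measurableType d') {R : realType}.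
Variables (m : {finite_measure set T -> \bar R}) (f : T -> T').
Hypothesis mf : measurable_fun setT f.

(** The proof of measurability is an argument so that the measure instance, which depends on it, can
    be attached. *)
Definition pushforward_finite & measurable_fun setT f : set T' -> \bar R :=
  pushforward m f.

Let m' := pushforward_finite mf.
HB.instance Definition _ := Measure.copy m'
  (measure_function_pushforward__canonical__measure_function_Measure m mf).

Let fin : fin_num_fun m'.
Proof.
move=> A mA; apply: fin_num_measure.
by rewrite -[X in measurable X]setTI; exact: mf.
Qed.

HB.instance Definition _ := Measure_isFinite.Build _ _ _ m' fin.

Definition finite_pushforward : {finite_measure set T' -> \bar R} := m'.

End pushforward_finite.

Section combination_finite.
Context d (T : measurableType d) {R : realType}.
Variables (a b : {nonneg R}) (m1 m2 : {finite_measure set T -> \bar R}).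

Definition measure_combination : set T -> \bar R :=
  measure_add (mscale a m1) (mscale b m2).

HB.instance Definition _ := Measure.on measure_combination.

Let fin : fin_num_fun measure_combination.
Proof.
move=> A mA; rewrite /measure_combination measure_addE /mscale/=.
by rewrite fin_numD !fin_numM// fin_num_measure.
Qed.

HB.instance Definition _ := Measure_isFinite.Build _ _ _ measure_combination fin.

Lemma measure_combinationE A : measure_combination A =
  (a%:num%:E * m1 A + b%:num%:E * m2 A)%E.
Proof. by rewrite /measure_combination measure_addE. Qed.

Lemma integral_measure_combination (X : set T) (f : T -> R) : measurable X ->
  bounded_measurable X f ->
  (\int[measure_combination]_(x in X) (f x)%:E =
   a%:num%:E * \int[m1]_(x in X) (f x)%:E + b%:num%:E * \int[m2]_(x in X) (f x)%:E)%E.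
Proof.
move=> mX bf.
have finX (m : {finite_measure set T -> \bar R}) : (m X < +oo)%E.
  by rewrite -ge0_fin_numE//; exact: fin_num_measure.
have I1 := bounded_measurable_integrable mX (finX m1) bf.
have I2 := bounded_measurable_integrable mX (finX m2) bf.
have finS k (m : {finite_measure set T -> \bar R}) : (mscale k m X < +oo)%E.
  by rewrite /mscale/= lte_mul_pinfty.
rewrite [LHS](integral_measure_add mX
  (bounded_measurable_integrable mX (finS a m1) bf)
  (bounded_measurable_integrable mX (finS b m2) bf)).
by rewrite !integral_mscale.
Qed.

End combination_finite.

(** * The Kantorovich problem *)

Section integral_transfer.
Context d d' (T : measurableType d) (T' : measurableType d') {R : realType}.

Lemma integral_concentrated (m : {measure set T -> \bar R}) (D1 D2 : set T)
    (f : T -> \bar R) :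
  measurable D1 -> measurable D2 -> D1 `<=` D2 -> m (D2 `\` D1) = 0%E ->
  m.-integrable D2 f ->
  (\int[m]_(x in D2) f x = \int[m]_(x in D1) f x)%E.
Proof.
move=> mD1 mD2 D12 m0 If.
rewrite (negligible_integral _ mD2 If m0) ?setDD; last exact: measurableD.
by rewrite setIC (setIidl D12).
Qed.

Lemma bounded_measurable_comp (g : T -> T') (X : set T') (f : T' -> R) :
  measurable_fun setT g -> measurable X -> bounded_measurable X f ->
  bounded_measurable (g @^-1` X) (f \o g).
Proof.
move=> mg mX [mf [B fB]]; split; last by exists B => x /fB.
have mfX : measurable_fun setT (f \_ X) by apply/(measurable_restrictT _ mX).1.
apply: (@eq_measurable_fun _ _ _ _ _ ((f \_ X) \o g)).
  by move=> x; rewrite inE /= => Xg; rewrite patchE mem_set.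
by apply: measurable_funTS; exact: measurableT_comp.
Qed.

Lemma bounded_measurable_sub (X Y : set T) (f : T -> R) : measurable Y ->
  Y `<=` X -> measurable X -> bounded_measurable X f -> bounded_measurable Y f.
Proof.
move=> mY YX mX [mf [B fB]]; split; last by exists B => x /YX/fB.
exact: measurable_funS mf.
Qed.

Lemma integral_pushforward_bounded (m : {finite_measure set T -> \bar R})
    (g : T -> T') (X : set T') (f : T' -> R) :
  measurable_fun setT g -> measurable X -> bounded_measurable X f ->
  (\int[pushforward m g]_(y in X) (f y)%:E =
   \int[m]_(x in g @^-1` X) (f (g x))%:E)%E.
Proof.
move=> mg mX bf; have [mf _] := bf.
have mgX : measurable (g @^-1` X) by rewrite -[X in measurable X]setTI; exact: mg.
have mfX : measurable_fun setT (EFin \o (f \_ X)).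
  by apply/measurable_EFinP; apply/(measurable_restrictT _ mX).1.
have If : m.-integrable (g @^-1` X) (EFin \o (f \_ X) \o g).
  apply: (@eq_integrable _ _ _ m _ mgX (EFin \o (f \o g))).
    by move=> x; rewrite inE /= => Xg; rewrite patchE mem_set.
  apply: bounded_measurable_integrable => //.
    by rewrite -ge0_fin_numE//; exact: fin_num_measure.
  exact: bounded_measurable_comp.
have := integral_pushforward mg mfX If mX.
rewrite (eq_integral (EFin \o f)); last first.
  by move=> x xX; rewrite /= patchE xX.
move=> ->; apply: eq_integral => x; rewrite inE /= => Xg.
by rewrite patchE mem_set.
Qed.

End integral_transfer.

Section kantorovich.
Context {R : realType} {d0 d1 : nat}.
Variables (w0 : set 'rV[R]_d0) (w1 : set 'rV[R]_d1).
Hypotheses (cw0 : compact w0) (cw1 : compact w1).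
Variables (u0 : {finite_measure set 'rV[R]_d0 -> \bar R}).
Variable c : 'rV[R]_d0 * 'rV[R]_d1 -> R.
Hypothesis cc : {within w0 `*` w1, continuous c}.
Implicit Types (u : {charge set 'rV[R]_d1 -> \bar R})
  (pi : {finite_measure set ('rV[R]_d0 * 'rV[R]_d1)%type -> \bar R})
  (phi : 'rV[R]_d0 -> R) (psi : 'rV[R]_d1 -> R).
Local Notation fst01 := (@fst 'rV[R]_d0 'rV[R]_d1).
Local Notation snd01 := (@snd 'rV[R]_d0 'rV[R]_d1).

Let mw0 : measurable w0. Proof. exact: compact_measurable_rV. Qed.
Let mw1 : measurable w1. Proof. exact: compact_measurable_rV. Qed.
Let mw01 : measurable (w0 `*` w1). Proof. exact: measurableX. Qed.
Let mfst : measurable_fun setT fst01. Proof. exact: measurable_fst. Qed.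
Let msnd : measurable_fun setT snd01. Proof. exact: measurable_snd. Qed.
Let mfst0 : measurable (fst01 @^-1` w0).
Proof. by rewrite -[X in measurable X]setTI; exact: mfst. Qed.
Let msnd1 : measurable (snd01 @^-1` w1).
Proof. by rewrite -[X in measurable X]setTI; exact: msnd. Qed.

Let finlty d (T : measurableType d) (m : {finite_measure set T -> \bar R}) A :
  measurable A -> (m A < +oo)%E.
Proof. by move=> mA; rewrite -ge0_fin_numE//; exact: fin_num_measure. Qed.

Lemma cost_bounded_measurable : bounded_measurable (w0 `*` w1) c.
Proof.
split; first exact: within_continuous_measurable_rV_prod.
by apply: within_continuous_compact_bounded => //; exact: compact_setX.
Qed.

(** A plan does not charge the cylinder over w0 outside w0 x w1, so the domain may be enlarged to a
    preimage under the projection. *)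
Lemma plan_integral_fst u pi phi : transport_plan w0 w1 u0 u pi ->
  bounded_measurable w0 phi ->
  \int[pi]_(z in w0 `*` w1) phi z.1 = \int[u0]_(x in w0) phi x.
Proof.
move=> [pi01 pi0 _] bphi; congr fine.
have bf := bounded_measurable_comp mfst mw0 bphi.
have If := bounded_measurable_integrable mfst0 (finlty pi mfst0) bf.
transitivity (\int[pi]_(z in fst01 @^-1` w0) ((phi \o fst01) z)%:E)%E.
  apply/esym; apply: (integral_concentrated mw01 mfst0 _ _ If).
    by move=> z [].
  apply: pi01; first exact: measurableD.
  by apply/seteqP; split => // z [[_ nz] /nz].
rewrite -[LHS](integral_pushforward_bounded pi mfst mw0 bphi).
by apply: eq_measure_integral => A mA _; exact: pi0.
Qed.

Lemma plan_integral_snd u pi psi : transport_plan w0 w1 u0 u pi ->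
  bounded_measurable w1 psi ->
  \int[pi]_(z in w0 `*` w1) psi z.2 = charge_integral u w1 psi.
Proof.
move=> [pi01 _ pi1] bpsi.
have bf := bounded_measurable_comp msnd mw1 bpsi.
have If := bounded_measurable_integrable msnd1 (finlty pi msnd1) bf.
transitivity (\int[pi]_(z in snd01 @^-1` w1) ((psi \o snd01) z)).
  congr fine; apply/esym; apply: (integral_concentrated mw01 msnd1 _ _ If).
    by move=> z [].
  apply: pi01; first exact: measurableD.
  by apply/seteqP; split => // z [[_ nz] /nz].
(* The second marginal is a measure, so it decomposes u with the zero measure as negative part. *)
rewrite (@charge_integral_diff _ _ _ _ mw1 u (finite_pushforward pi msnd) mzero)//.
- rewrite [X in _ - X](_ : _ = 0) ?subr0; last first.
    by rewrite /Rintegral integral_measure_zero.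
  by congr fine; rewrite -[LHS](integral_pushforward_bounded pi msnd mw1 bpsi).
- exact: finlty.
- by rewrite /mzero/= ltry.
- by move=> A mA; rewrite /mzero/= sube0 -pi1.
Qed.

Lemma plan_cost_ge u pi phi psi : transport_plan w0 w1 u0 u pi ->
  dual_feasible w0 w1 c phi psi ->
  ((dual_value w0 w1 u0 u phi psi)%:E <= \int[pi]_(z in w0 `*` w1) (c z)%:E)%E.
Proof.
move=> tpi [cphi cpsi le_c].
have bphi := within_continuous_bounded_measurable cw0 cphi.
have bpsi := within_continuous_bounded_measurable cw1 cpsi.
have b1 : bounded_measurable (w0 `*` w1) (phi \o fst01).
  apply: (bounded_measurable_sub _ _ mfst0); [exact: mw01|by move=> z []|].
  exact: bounded_measurable_comp.
have b2 : bounded_measurable (w0 `*` w1) (psi \o snd01).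
  apply: (bounded_measurable_sub _ _ msnd1); [exact: mw01|by move=> z []|].
  exact: bounded_measurable_comp.
have pioo := finlty pi mw01.
have Ic := bounded_measurable_integrable mw01 pioo cost_bounded_measurable.
have Is := bounded_measurable_integrable mw01 pioo (bounded_measurable_lin 1 b1 b2).
have -> : dual_value w0 w1 u0 u phi psi =
    \int[pi]_(z in w0 `*` w1) (1 * phi z.1 + psi z.2).
  rewrite (Rintegral_lin _ mw01 pioo b1 b2) mul1r.
  by rewrite /dual_value -(plan_integral_fst tpi bphi) -(plan_integral_snd tpi bpsi).
rewrite fineK; last exact: (integrable_fin_num mw01 Is).
apply: (le_integral mw01 Is Ic) => -[x xi]; rewrite inE => -[/= w0x w1xi].
by rewrite lee_fin mul1r; exact: le_c.
Qed.

Lemma weak_duality u phi psi : dual_feasible w0 w1 c phi psi ->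
  ((dual_value w0 w1 u0 u phi psi)%:E <= transport_cost w0 w1 u0 c u)%E.
Proof.
by move=> fp; apply: le_ereal_inf_tmp => _ [pi tpi <-]; exact: plan_cost_ge.
Qed.

Lemma plan_cost_fin_num pi : (\int[pi]_(z in w0 `*` w1) (c z)%:E)%E \is a fin_num.
Proof.
have := bounded_measurable_integrable mw01 (finlty pi mw01) cost_bounded_measurable.
exact: (integrable_fin_num mw01).
Qed.

Lemma transport_plan_combination (a b : {nonneg R}) u1 u2 u pi1 pi2 :
  a%:num + b%:num = 1 ->
  (forall A, measurable A -> u A = (a%:num%:E * u1 A + b%:num%:E * u2 A)%E) ->
  transport_plan w0 w1 u0 u1 pi1 -> transport_plan w0 w1 u0 u2 pi2 ->
  transport_plan w0 w1 u0 u (measure_combination a b pi1 pi2).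
Proof.
move=> ab uE [c1 f1 s1] [c2 f2 s2]; split.
- move=> A mA A0; rewrite [LHS]measure_combinationE.
  by rewrite c1// c2// !mule0 adde0.
- move=> A mA; rewrite [LHS]measure_combinationE.
  rewrite [pi1 _]f1// [pi2 _]f2// -muleDl//; last exact: fin_num_measure.
  by rewrite -EFinD ab mul1e.
- move=> A mA; rewrite [LHS]measure_combinationE uE//.
  by rewrite [pi1 _]s1// [pi2 _]s2.
Qed.

(** Convexity in terms of plans instead of costs keeps the right-hand side finite. *)
Lemma transport_cost_combination_le (a b : {nonneg R}) u1 u2 u pi1 pi2 :
  a%:num + b%:num = 1 ->
  (forall A, measurable A -> u A = (a%:num%:E * u1 A + b%:num%:E * u2 A)%E) ->
  transport_plan w0 w1 u0 u1 pi1 -> transport_plan w0 w1 u0 u2 pi2 ->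
  (transport_cost w0 w1 u0 c u <=
   a%:num%:E * \int[pi1]_(z in w0 `*` w1) (c z)%:E +
   b%:num%:E * \int[pi2]_(z in w0 `*` w1) (c z)%:E)%E.
Proof.
move=> ab uE t1 t2.
rewrite -(integral_measure_combination a b pi1 pi2 mw01 cost_bounded_measurable).
apply: ereal_inf_lbound; exists (measure_combination a b pi1 pi2) => //.
exact: transport_plan_combination t1 t2.
Qed.

End kantorovich.

(** * Conjugate functions and measurable selections *)

Section dual_optimality.
Context {R : realType} {d0 d1 : nat}.
Variables (w0 : set 'rV[R]_d0) (w1 : set 'rV[R]_d1).
Hypotheses (cw0 : compact w0) (cw1 : compact w1) (w10 : w1 !=set0).
Variables (u0 : {finite_measure set 'rV[R]_d0 -> \bar R}).
Hypothesis u0w0 : concentrated w0 u0.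
Variable c : 'rV[R]_d0 * 'rV[R]_d1 -> R.
Hypothesis cc : {within w0 `*` w1, continuous c}.
Implicit Types (u : {charge set 'rV[R]_d1 -> \bar R})
  (phi : 'rV[R]_d0 -> R) (psi zeta : 'rV[R]_d1 -> R).

Let mw0 : measurable w0. Proof. exact: compact_measurable_rV. Qed.
Let mw1 : measurable w1. Proof. exact: compact_measurable_rV. Qed.
Let mw01 : measurable (w0 `*` w1). Proof. exact: measurableX. Qed.
Let u0lty A : measurable A -> (u0 A < +oo)%E.
Proof. by move=> mA; rewrite -ge0_fin_numE//; exact: fin_num_measure. Qed.

(** The control is T_# u0, coupled to u0 by (id, T)_# u0; this plan need not be optimal, hence the
    inequality. *)
Lemma graph_plan (T : 'rV[R]_d0 -> 'rV[R]_d1) : measurable_fun setT T ->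
  (forall x, w0 x -> w1 (T x)) ->
  exists u, [/\ concentrated w1 u,
    bounded_measurable w0 (fun x => c (x, T x)),
    (transport_cost w0 w1 u0 c u <= (\int[u0]_(x in w0) c (x, T x))%:E)%E &
    forall psi, bounded_measurable w1 psi ->
      bounded_measurable w0 (psi \o T) /\
      charge_integral u w1 psi = \int[u0]_(x in w0) psi (T x)].
Proof.
move=> mT T01.
pose g x := (x, T x).
have mg : measurable_fun setT g by apply/measurable_fun_pair.
pose pi := finite_pushforward u0 mg.
pose u : {charge set 'rV[R]_d1 -> \bar R} :=
  charge_of_finite_measure (finite_pushforward u0 mT).
have mTw1 : measurable (T @^-1` w1).
  by rewrite -[X in measurable X]setTI; exact: (mT measurableT w1 mw1).
have gw : g @^-1` (w0 `*` w1) = w0.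
  by apply/seteqP; split => [x []//|x w0x]; split => //=; exact: T01.
have bc := cost_bounded_measurable cw0 cw1 cc.
have bcg : bounded_measurable w0 (c \o g).
  by rewrite -gw; exact: bounded_measurable_comp.
exists u; split => //.
- move=> A mA Aw1; apply: u0w0.
    by rewrite -[X in measurable X]setTI; exact: (mT measurableT A mA).
  apply/seteqP; split => // x [/= ATx /T01 w1Tx].
  by rewrite -[False]/(set0 (T x)) -Aw1.
- have -> : ((\int[u0]_(x in w0) c (x, T x))%:E =
      \int[pi]_(z in w0 `*` w1) (c z)%:E)%E.
    have := integral_pushforward_bounded u0 mg mw01 bc; rewrite gw => E.
    rewrite [RHS]E fineK//; apply: (integrable_fin_num mw0).
    by apply: bounded_measurable_integrable => //; exact: u0lty.
  apply: ereal_inf_lbound; exists pi => //; split => //.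
  move=> A mA Aw; apply: u0w0.
    by rewrite -[X in measurable X]setTI; exact: (mg measurableT A mA).
  apply/seteqP; split => // x [/= Agx w0x].
  by rewrite -[False]/(set0 (g x)) -Aw; split => //; split => //; exact: T01.
move=> psi bpsi; have bT := bounded_measurable_comp mT mw1 bpsi.
split; first exact: (bounded_measurable_sub mw0 T01 mTw1).
rewrite (@charge_integral_diff _ _ _ _ mw1 u (finite_pushforward u0 mT) mzero)//.
- rewrite [X in _ - X](_ : _ = 0) ?subr0; last first.
    by rewrite /Rintegral integral_measure_zero.
  congr fine; rewrite [LHS](integral_pushforward_bounded u0 mT mw1 bpsi).
  apply: (integral_concentrated mw0 mTw1 T01).
    apply: u0w0; first exact: measurableD.
    by apply/seteqP; split => // x [[_ nx] /nx].
  by apply: bounded_measurable_integrable => //; exact: u0lty.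
- by rewrite -ge0_fin_numE//; exact: fin_num_measure.
- by rewrite /mzero/= ltry.
- by move=> A mA; rewrite /mzero/= sube0.
Qed.

(** Compactness of w1 makes one neighbourhood of x0 serve all xi. *)
Lemma cost_equicontinuous x0 (e : R) : w0 x0 -> 0 < e ->
  \forall x \near within w0 (nbhs x0), forall xi, w1 xi ->
    `|c (x, xi) - c (x0, xi)| < e.
Proof.
move=> w0x0 e0.
(* The covering property quantifies over full neighbourhoods of points of w1, so membership is made
   a premise. *)
pose P x xi := w0 x -> w1 xi -> `|c (x, xi) - c (x0, xi)| < e.
have H : \forall x \near within w0 (nbhs x0), w1 `<=` P x.
  apply: ((compact_near_coveringP w1).1 cw1) => xi0 w1xi0.
  have e2 : 0 < e / 2 by rewrite divr_gt0.
  have /cvgrPdist_lt/(_ _ e2) := ((subspace_continuousP (w0 `*` w1) c).1 cc) (x0, xi0) (conj w0x0 w1xi0).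
  move=> /nbhs_ballP[d /= dp Hd].
  exists (ball xi0 d, fun x => w0 x -> ball x0 d x).
    split => /=; first exact: nbhsx_ballx.
    by move: (nbhsx_ballx x0 d dp); apply: filterS => x bx _ _.
  move=> [xi x] [/= bxi bx] w0x w1xi.
  have h1 := Hd (x, xi) (conj (bx w0x) bxi) (conj w0x w1xi).
  have h2 := Hd (x0, xi) (conj (ballxx _ dp) bxi) (conj w0x0 w1xi).
  have -> : c (x, xi) - c (x0, xi) =
    (c (x0, xi0) - c (x0, xi)) - (c (x0, xi0) - c (x, xi)) by ring.
  by apply: le_lt_trans (ler_normB _ _) _; move: h1 h2 => /=; lra.
have W : \forall x \near within w0 (nbhs x0), w0 x by exact: withinT.
by apply: filterS2 H W => x Hx w0x xi w1xi; exact: Hx.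
Qed.

Lemma cost_section_continuous xi : w1 xi -> {within w0, continuous (fun x => c (x, xi))}.
Proof.
move=> w1xi; apply/subspace_continuousP => x0 w0x0; apply/cvgrPdist_lt => e e0.
by apply: filterS (cost_equicontinuous w0x0 e0) => x Hx; rewrite distrC; exact: Hx.
Qed.

Section c_conjugate.
Variable zeta : 'rV[R]_d1 -> R.
Hypothesis czeta : {within w1, continuous zeta}.

Let has_lb x : w0 x -> has_lbound [set c (x, xi) - zeta xi | xi in w1].
Proof.
have [_ [B cB]] := cost_bounded_measurable cw0 cw1 cc.
have [_ [C zC]] := within_continuous_bounded_measurable cw1 czeta.
move=> w0x; exists (- B - C) => _ [xi w1xi <-].
have := cB (x, xi) (conj w0x w1xi); have := zC xi w1xi.
by rewrite !ler_norml => /andP[_ ?] /andP[? _]; exact: lerB.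
Qed.

Lemma c_conjugate_le x xi : w0 x -> w1 xi ->
  c_conjugate w1 c zeta x <= c (x, xi) - zeta xi.
Proof. by move=> w0x w1xi; apply: ge_inf; [exact: has_lb|exists xi]. Qed.

Lemma le_c_conjugate x (r : R) : (forall xi, w1 xi -> r <= c (x, xi) - zeta xi) ->
  r <= c_conjugate w1 c zeta x.
Proof.
move=> H; apply: lb_le_inf; last by move=> _ [xi w1xi <-]; exact: H.
by have [xi w1xi] := w10; exists (c (x, xi) - zeta xi); exists xi.
Qed.

Lemma c_conjugate_continuous : {within w0, continuous (c_conjugate w1 c zeta)}.
Proof.
apply/subspace_continuousP => x0 w0x0; apply/cvgrPdist_le => e e0.
have W : \forall x \near within w0 (nbhs x0), w0 x by exact: withinT.
apply: filterS2 (cost_equicontinuous w0x0 e0) W => x Hx w0x.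
have h1 : c_conjugate w1 c zeta x0 - e <= c_conjugate w1 c zeta x.
  apply: le_c_conjugate => xi w1xi; have := c_conjugate_le w0x0 w1xi.
  by have := Hx xi w1xi; rewrite ltr_norml => /andP[]; lra.
have h2 : c_conjugate w1 c zeta x - e <= c_conjugate w1 c zeta x0.
  apply: le_c_conjugate => xi w1xi; have := c_conjugate_le w0x w1xi.
  by have := Hx xi w1xi; rewrite ltr_norml => /andP[]; lra.
by rewrite ler_norml; apply/andP; split; lra.
Qed.

Lemma dual_feasible_c_conjugate : dual_feasible w0 w1 c (c_conjugate w1 c zeta) zeta.
Proof.
split => //; first exact: c_conjugate_continuous.
by move=> x xi w0x w1xi; rewrite -lerBrDr c_conjugate_le.
Qed.

(** An almost-minimizer at x remains one near x, because the gap [G] is continuous in x. Finitely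
    many points xi thus serve all of w0, and T takes only finitely many values. *)
Lemma c_conjugate_selection (e : R) : 0 < e ->
  exists T : 'rV[R]_d0 -> 'rV[R]_d1, [/\ measurable_fun setT T,
    forall x, w0 x -> w1 (T x) &
    forall x, w0 x -> c (x, T x) - zeta (T x) <= c_conjugate w1 c zeta x + e].
Proof.
move=> e0; pose G x xi := c (x, xi) - zeta xi - c_conjugate w1 c zeta x.
(* The sets are open in the whole space, which serves both the cover and measurability; for xi
   outside w1 an arbitrary value makes the choice total. *)
have /choice[Ox HO] xi : exists V : set 'rV[R]_d0, open V /\
    (w1 xi -> forall x, w0 x -> (V x <-> G x xi < e)).
  have [w1xi|nw1xi] := pselect (w1 xi); last by exists set0; split => //; exact: open0.
  have cG : {within w0, continuous (G ^~ xi)}.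
    apply/subspace_continuousP => x w0x; apply: cvgB.
      apply: cvgB; last exact: cvg_cst.
      exact: ((subspace_continuousP w0 _).1 (cost_section_continuous w1xi)).
    exact: ((subspace_continuousP w0 _).1 c_conjugate_continuous).
  have [V oV VE] := within_continuous_preimage cG (@open_lt R e).
  exists V; split => // _ x w0x; split => [Vx|Gx].
    by have : (w0 `&` V) x by []; rewrite -VE => -[].
  by have : (w0 `&` [set x | G x xi < e]) x by []; rewrite VE => -[].
have covO : w0 `<=` cover w1 Ox.
  move=> x w0x; have [xi [w1xi Gxi]] : exists xi, w1 xi /\ G x xi < e.
    have hi : has_inf [set c (x, xi) - zeta xi | xi in w1].
      split; last exact: has_lb.
      by have [eta w1eta] := w10; exists (c (x, eta) - zeta eta); exists eta.
    have [_ [xi w1xi <-] Hxi] := inf_adherent e0 hi.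
    by exists xi; split => //; rewrite /G ltrBlDl.
  by exists xi => //; apply/((HO xi).2 w1xi x w0x).
move: cw0; rewrite compact_cover => /(_ _ w1 Ox (fun xi _ => (HO xi).1) covO)[D Dw1 w0D].
(* The first set in the list that contains x decides. For the empty list the requirement is void, so
   any constant will do. *)
have sel (s : seq 'rV[R]_d1) : exists T : 'rV[R]_d0 -> 'rV[R]_d1,
    measurable_fun setT T /\
    forall x, (exists2 xi, xi \in s & Ox xi x) -> T x \in s /\ Ox (T x) x.
  elim: s => [|xi s [T [mT HT]]].
    by exists (cst 0); split => // x [].
  exists (fun x => if x \in Ox xi then xi else T x); split.
    apply: measurable_fun_ifT => //.
    apply: (measurable_fun_bool true); rewrite setTI.
    rewrite (_ : _ @^-1` _ = Ox xi); last by apply/seteqP; split => x /= => [/set_mem|/mem_set].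
    by apply: open_measurable_rV; exact: (HO xi).1.
  move=> x [eta]; case: ifPn => [|nO]; first by rewrite inE => Oxi; rewrite mem_head.
  rewrite inE => /predU1P[->|es Oe]; first by move=> Oe; move/negP: nO; rewrite inE.
  by have [Ts OT] := HT x (ex_intro2 _ _ eta es Oe); rewrite inE Ts orbT.
have [T [mT HT]] := sel (finmap.enum_fset D).
have TO (x : 'rV[R]_d0) : w0 x -> w1 (T x) /\ Ox (T x) x.
  move=> w0x; have [xi Dxi Oxi] := w0D x w0x.
  have [TxD OT] := HT x (ex_intro2 _ _ xi Dxi Oxi).
  by split => //; have := Dw1 _ TxD; rewrite inE.
exists T; split => // x w0x; have [w1T OT] := TO x w0x.
  by [].
by have /((HO (T x)).2 w1T x w0x) := OT; rewrite /G; lra.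
Qed.

End c_conjugate.

Lemma subdifferential_le_dual_value (ubar : {charge set 'rV[R]_d1 -> \bar R}) psi :
  concentrated w1 ubar -> transport_cost w0 w1 u0 c ubar \is a fin_num ->
  transport_subdifferential w0 w1 u0 c ubar psi ->
  (transport_cost w0 w1 u0 c ubar <=
   (dual_value w0 w1 u0 ubar (c_conjugate w1 c psi) psi)%:E)%E.
Proof.
move=> cubar; case E : (transport_cost w0 w1 u0 c ubar) => [D| |]// _ [cpsi sub].
(* A pointwise error 1/(k+1) integrates to that multiple of the mass of u0. *)
rewrite lee_fin; apply: (@le_harmonicP _ _ _ (fine (u0 w0))) => k.
have k0 : 0 < k.+1%:R^-1 :> R by rewrite invr_gt0.
have [T [mT T01 Tle]] := c_conjugate_selection cpsi k0.
have bpsi := within_continuous_bounded_measurable cw1 cpsi.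
have bcpsi := within_continuous_bounded_measurable cw0 (c_conjugate_continuous cpsi).
have [u [cu bcT uc uint]] := graph_plan mT T01.
have [bpsiT upsi] := uint _ bpsi.
have := le_trans (sub u cu) uc.
rewrite E -EFinD lee_fin charge_integral_cadd// charge_integral_copp// upsi.
have bk : bounded_measurable w0 (cst (k.+1%:R^-1 : R)).
  by split => //; exists (k.+1%:R^-1 : R) => x _; rewrite gtr0_norm.
have I f : bounded_measurable w0 f -> u0.-integrable w0 (EFin \o f).
  by move=> bf; apply: bounded_measurable_integrable => //; exact: u0lty.
have : \int[u0]_(x in w0) c (x, T x) - \int[u0]_(x in w0) psi (T x) <=
    \int[u0]_(x in w0) c_conjugate w1 c psi x + fine (u0 w0) * k.+1%:R^-1.
  have -> : fine (u0 w0) * k.+1%:R^-1 = \int[u0]_(x in w0) (cst (k.+1%:R^-1 : R) x).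
    by rewrite mulrC Rintegral_cst.
  rewrite -RintegralB//; [|exact: I|exact: I].
  rewrite -RintegralD//; [|exact: I|exact: I].
  apply: le_Rintegral => //.
  - have := bounded_measurable_lin (-1) bpsiT bcT => /I; apply: eq_integrable => //.
    by move=> x _ /=; rewrite mulN1r addrC.
  - have := bounded_measurable_lin 1 bcpsi bk => /I; apply: eq_integrable => //.
    by move=> x _ /=; rewrite mul1r.
rewrite /dual_value; move: (fine _ * _) => t; lra.
Qed.

End dual_optimality.

(** * First-order conditions *)

Section subdifferential_duality.
Context {R : realType} {d0 d1 : nat}.
Variables (w0 : set 'rV[R]_d0) (w1 : set 'rV[R]_d1).
Hypotheses (cw0 : compact w0) (cw1 : compact w1) (w10 : w1 !=set0).
Variables (u0 : {finite_measure set 'rV[R]_d0 -> \bar R}).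
Hypothesis u0w0 : concentrated w0 u0.
Variable c : 'rV[R]_d0 * 'rV[R]_d1 -> R.
Hypothesis cc : {within w0 `*` w1, continuous c}.
Variable ubar : {charge set 'rV[R]_d1 -> \bar R}.
Hypotheses (cubar : concentrated w1 ubar)
  (dubar : (transport_cost w0 w1 u0 c ubar < +oo)%E).
Implicit Types (psi : 'rV[R]_d1 -> R).
Local Notation D := (transport_cost w0 w1 u0 c).

Let mw1 : measurable w1. Proof. exact: compact_measurable_rV. Qed.

(** The zero function and its conjugate form a feasible pair, so weak duality bounds the cost from
    below. *)
Lemma transport_cost_fin_num : D ubar \is a fin_num.
Proof.
have c0 : {within w1, continuous (fun=> 0 : R)}.
  by apply: continuous_subspaceT => x; exact: cst_continuous.
have := weak_duality cw0 cw1 u0 cc ubar (dual_feasible_c_conjugate cw0 cw1 w10 cc c0).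
by case: (D ubar) dubar.
Qed.

Lemma eq_transport_subdifferential psi psi' : {in w1, psi =1 psi'} ->
  transport_subdifferential w0 w1 u0 c ubar psi ->
  transport_subdifferential w0 w1 u0 c ubar psi'.
Proof.
move=> E [cpsi sub]; split; first exact: subspace_eq_continuous E cpsi.
by move=> u cu; rewrite -(eq_charge_integral _ E); exact: sub.
Qed.

Lemma subdifferential_dual_solution psi :
  transport_subdifferential w0 w1 u0 c ubar psi ->
  dual_solution w0 w1 u0 c ubar (c_conjugate w1 c psi) psi.
Proof.
move=> sub; have [cpsi _] := sub; split; first exact: dual_feasible_c_conjugate.
move=> phi' psi' fp; rewrite -lee_fin.
apply: le_trans (weak_duality cw0 cw1 u0 cc ubar fp) _.
by apply: subdifferential_le_dual_value => //; exact: transport_cost_fin_num.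
Qed.

(* The existence of some subgradient [psi0] replaces strong Kantorovich duality:
   it makes the dual optimal value at least [D ubar]. *)
Lemma dual_solution_subdifferential psi0 psi :
  transport_subdifferential w0 w1 u0 c ubar psi0 ->
  {within w1, continuous psi} ->
  dual_solution w0 w1 u0 c ubar (c_conjugate w1 c psi) psi ->
  transport_subdifferential w0 w1 u0 c ubar psi.
Proof.
move=> sub0 cpsi [_ sol]; split => // u cu; have [cpsi0 _] := sub0.
have bpsi := within_continuous_bounded_measurable cw1 cpsi.
have f0 := dual_feasible_c_conjugate cw0 cw1 w10 cc cpsi0.
have fp := dual_feasible_c_conjugate cw0 cw1 w10 cc cpsi.
apply: le_trans (weak_duality cw0 cw1 u0 cc u fp).
rewrite charge_integral_cadd// charge_integral_copp//.
have -> : dual_value w0 w1 u0 u (c_conjugate w1 c psi) psi =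
    dual_value w0 w1 u0 ubar (c_conjugate w1 c psi) psi +
    (charge_integral u w1 psi - charge_integral ubar w1 psi).
  by rewrite /dual_value; ring.
rewrite [leRHS]EFinD leeD2r//.
apply: (@le_trans _ _ (dual_value w0 w1 u0 ubar (c_conjugate w1 c psi0) psi0)%:E).
  by apply: subdifferential_le_dual_value => //; exact: transport_cost_fin_num.
by rewrite lee_fin; exact: sol.
Qed.

End subdifferential_duality.

(** * The control-to-state operator and the adjoint equation *)

Section state_operator.
Context {R : realType} {n : nat}.
Variables (Om w1 : set 'rV[R]_n.+1) (q : R).
Hypotheses (oOm : open Om) (bOm : bounded_set Om) (cw1 : compact w1)
  (w1Om : w1 `<=` closure Om) (q1 : 1 < q) (nq : n.+1%:R < conj_exp q)
  (solvable : poisson_uniquely_solvable Om q).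
Local Notation s := (conj_exp q).
Local Notation E := (sobolev_embedding Om).
Local Notation S := (control_to_state Om w1 q).
Implicit Types (u : {charge set 'rV[R]_n.+1 -> \bar R}) (y z v p : @sobolev_fun R n.+1).

Let mOm : measurable Om. Proof. exact: open_measurable_rV. Qed.
Let mw1 : measurable w1. Proof. exact: compact_measurable_rV. Qed.

Lemma sobolev_embedding_within_continuous p : W10 Om s p ->
  {within w1, continuous (E p)}.
Proof.
move=> /(sobolev_embeddingP oOm bOm nq)[cEp _ _].
exact: (continuous_subspaceW w1Om cEp).
Qed.

Lemma sobolev_embedding_bounded_measurable p : W10 Om s p ->
  bounded_measurable w1 (E p).
Proof.
move=> Wp; apply: within_continuous_bounded_measurable => //.
exact: sobolev_embedding_within_continuous.
Qed.

Lemma embedding_adjoint_Wm1 u : Wm1 Om q (embedding_adjoint Om w1 u).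
Proof.
split=> [a y z Wy Wz|].
  rewrite /embedding_adjoint -charge_integral_lin//; last 2 first.
  - exact: sobolev_embedding_bounded_measurable.
  - exact: sobolev_embedding_bounded_measurable.
  apply: eq_charge_integral => x; rewrite inE => /w1Om clx.
  exact: (sobolev_embedding_lin oOm bOm nq a Wy Wz clx).
have [C C0 HC] := sobolev_embedding_bound oOm bOm nq.
have [K K0 HK] := charge_integral_norm_le mw1 u.
exists (C * K) => y Wy; have Ly := W1_W1_Lp Wy.1.
have := W1norm_lty Ly; have := W1norm_ge0 Om s y.
case Ew : (W1norm Om s y) => [w| |]// _ _; rewrite -EFinM lee_fin mulrAC.
apply: HK; first by have [] := sobolev_embedding_bounded_measurable Wy.
by move=> x /w1Om clx; rewrite -lee_fin EFinM -Ew; exact: HC.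
Qed.

Lemma control_to_stateP u : W10 Om q (S u) /\
  poisson Om q (embedding_adjoint Om w1 u) (S u).
Proof.
have [[y Wy Py] _] := solvable (embedding_adjoint_Wm1 u).
exact: (@xgetPex _ 0 [set y | W10 Om q y /\ poisson Om q (embedding_adjoint Om w1 u) y]
  (ex_intro _ y (conj Wy Py))).
Qed.

Lemma neg_laplacianC y v : neg_laplacian Om y v = neg_laplacian Om v y.
Proof.
by apply: eq_Rintegral => x _; apply: eq_bigr => i _; rewrite mulrC.
Qed.

Lemma neg_laplacian_lin a y z v : W1 Om q y -> W1 Om q z -> W1 Om s v ->
  neg_laplacian Om (a *: y + z) v = a * neg_laplacian Om y v + neg_laplacian Om z v.
Proof.
have [s0 qs _ _] := conj_expP q1; have q0 : 0 < q by exact: lt_trans q1.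
move=> [_ Ly _] [_ Lz _] [_ Lv _].
have I (f : 'I_n.+1 -> 'rV[R]_n.+1 -> R) : (forall i, in_Lp Om q (f i)) ->
    (lebesgue_rV n.+1).-integrable Om (EFin \o (fun x => \sum_(i < n.+1) f i x * v.2 i x)).
  move=> Lf; apply: (@eq_integrable _ _ _ _ _ mOm
      (fun x => (\sum_(i < n.+1) (f i x * v.2 i x)%:E)%E)).
    by move=> x _ /=; rewrite sumEFin.
  apply: integrable_sum => // i _.
  by have [mf Nf] := Lf i; have [mv Nv] := Lv i; exact: (integrable_mul_conjugate mOm q0 s0 qs).
rewrite /neg_laplacian -RintegralZl//; last exact: I.
rewrite -RintegralD//; last 2 first.
- exact: (integrableZl mOm a (I _ Ly)).
- exact: I.
apply: eq_Rintegral => x _; rewrite mulr_sumr -big_split/=.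
by apply: eq_bigr => i _; rewrite mulrA -mulrDl.
Qed.

Lemma W10B r y z : 1 < r -> W10 Om r y -> W10 Om r z -> W10 Om r (y - z).
Proof. by move=> r1 Wy Wz; rewrite addrC -scaleN1r; exact: W10_lin. Qed.

(** This is what makes J(S u) independent of the solution selected by [xget]. *)
Lemma eq_continuous_on_W10 (J : @sobolev_fun R n.+1 -> R) y z :
  continuous_on_W10 Om q J -> W10 Om q y -> W10 Om q z ->
  W1norm Om q (z - y) = 0%E -> J z = J y.
Proof.
move=> cJ Wy Wz zy; apply/eqP; rewrite -subr_eq0 -normr_le0 leNgt; apply/negP => H.
by have [d d0 /(_ z Wz)] := cJ y Wy _ H; rewrite zy lte_fin => /(_ d0); rewrite ltxx.
Qed.

(** Both arguments of J solve the same equation and thus have distance 0, though they may differ as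
    pairs. The control u is described by its integrals only, so no equality of charges is
    required. *)
Lemma control_to_state_affine (J : @sobolev_fun R n.+1 -> R) u1 u2 u (t : R) :
  continuous_on_W10 Om q J ->
  (forall f, bounded_measurable w1 f -> charge_integral u w1 f =
     charge_integral u1 w1 f + t * (charge_integral u2 w1 f - charge_integral u1 w1 f)) ->
  J (S u) = J (S u1 + t *: (S u2 - S u1)).
Proof.
move=> cJ uE; have [W1' P1'] := control_to_stateP u1.
have [W2' P2'] := control_to_stateP u2; have [Wu Pu] := control_to_stateP u.
have Wz : W10 Om q (S u1 + t *: (S u2 - S u1)).
  by rewrite addrC; apply: W10_lin => //; exact: W10B.
apply: eq_continuous_on_W10 => //.
have [_ uniq] := solvable (embedding_adjoint_Wm1 u).
apply: uniq => // v Wv; rewrite addrC.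
have [Wv1 _] := Wv.
rewrite (neg_laplacian_lin _ (W10B q1 W2' W1').1 W1'.1 Wv1).
rewrite [S u2 - _]addrC -scaleN1r (neg_laplacian_lin _ W1'.1 W2'.1 Wv1).
rewrite P1'// P2'// /embedding_adjoint uE; first by ring.
exact: sobolev_embedding_bounded_measurable.
Qed.

Lemma adjoint_state_identity u1 u2 p (F : @sobolev_fun R n.+1 -> R) :
  W10 Om s p -> poisson Om s F p ->
  F (S u2 - S u1) = charge_integral (cadd u2 (copp u1)) w1 (E p).
Proof.
move=> Wp Pp; have [W1' P1'] := control_to_stateP u1.
have [W2' P2'] := control_to_stateP u2.
have [_ _ ss _] := conj_expP q1.
have bE := sobolev_embedding_bounded_measurable Wp.
rewrite -Pp; last by rewrite ss; exact: W10B.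
rewrite neg_laplacianC [S u2 - _]addrC -scaleN1r (neg_laplacian_lin _ W1'.1 W2'.1 Wp.1).
rewrite P1'// P2'// charge_integral_cadd// charge_integral_copp// mulN1r addrC.
by [].
Qed.

End state_operator.

(** * Variations of the reduced functional *)

Section optimality.
Context {R : realType} {d0 n : nat}.
Variables (Om w1 : set 'rV[R]_n.+1) (w0 : set 'rV[R]_d0) (q : R).
Hypotheses (oOm : open Om) (bOm : bounded_set Om) (cw0 : compact w0) (cw1 : compact w1)
  (w10 : w1 !=set0) (w1Om : w1 `<=` closure Om) (q1 : 1 < q)
  (nq : n.+1%:R < conj_exp q) (solvable : poisson_uniquely_solvable Om q).
Variables (u0 : {finite_measure set 'rV[R]_d0 -> \bar R}).
Hypothesis u0w0 : concentrated w0 u0.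
Variable c : 'rV[R]_d0 * 'rV[R]_n.+1 -> R.
Hypothesis cc : {within w0 `*` w1, continuous c}.
Variables (alpha : R) (J : @sobolev_fun R n.+1 -> R)
  (DJ : @sobolev_fun R n.+1 -> @sobolev_fun R n.+1 -> R).
Hypotheses (alpha0 : 0 < alpha) (cJ : continuous_on_W10 Om q J)
  (dJ : forall y, W10 Om q y -> is_gateaux_derivative Om q J y (DJ y)).
Implicit Types (u : {charge set 'rV[R]_n.+1 -> \bar R}) (p : @sobolev_fun R n.+1).
Local Notation s := (conj_exp q).
Local Notation E := (sobolev_embedding Om).
Local Notation S := (control_to_state Om w1 q).
Local Notation D := (transport_cost w0 w1 u0 c).

Let mw1 : measurable w1. Proof. exact: compact_measurable_rV. Qed.

(** A single small positive t drawn from the two-sided limit suffices for the one-sided estimates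
    that follow. *)
Lemma gateaux_quotient y h (e t0 : R) : W10 Om q y -> W10 Om q h -> 0 < e -> 0 < t0 ->
  exists2 t : R, 0 < t < t0 & `|DJ y h - t^-1 * (J (y + t *: h) - J y)| < e.
Proof.
move=> Wy Wh e0 t00; have [_ /(_ h Wh)/cvgrPdist_lt/(_ _ e0)] := dJ Wy.
move=> /nbhs_ballP[d /= dp Hd].
pose t := Num.min (d / 2) (t0 / 2).
have t_gt0 : 0 < t by rewrite lt_min !divr_gt0.
have tt0 : t < t0 by rewrite gt_min; apply/orP; right; lra.
have td : t < d by rewrite gt_min; apply/orP; left; lra.
exists t; first by rewrite t_gt0.
have := Hd t; rewrite -ball_normE /ball_/= sub0r normrN gtr0_norm// => /(_ td).
by rewrite gt_eqF// => /(_ isT).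
Qed.

Lemma gateaux_ge y h (r t0 : R) : W10 Om q y -> W10 Om q h -> 0 < t0 ->
  (forall t, 0 < t < t0 -> r <= t^-1 * (J (y + t *: h) - J y)) -> r <= DJ y h.
Proof.
move=> Wy Wh t00 H; apply/ler_addgt0Pr => e e0.
have [t /H rt] := gateaux_quotient Wy Wh e0 t00.
by rewrite ltr_norml => /andP[+ _]; move: rt; lra.
Qed.

Lemma gateaux_le y h (r t0 : R) : W10 Om q y -> W10 Om q h -> 0 < t0 ->
  (forall t, 0 < t < t0 -> t^-1 * (J (y + t *: h) - J y) <= r) -> DJ y h <= r.
Proof.
move=> Wy Wh t00 H; apply/ler_addgt0Pr => e e0.
have [t /H rt] := gateaux_quotient Wy Wh e0 t00.
by rewrite ltr_norml => /andP[_]; move: rt; lra.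
Qed.

Section at_control.
Variable ubar : {charge set 'rV[R]_n.+1 -> \bar R}.
Hypotheses (cubar : concentrated w1 ubar) (Dubar : (D ubar < +oo)%E).
Local Notation ybar := (S ubar).

Let Dfin : D ubar \is a fin_num.
Proof. exact: transport_cost_fin_num. Qed.

Let Wybar : W10 Om q ybar.
Proof. by have [] := control_to_stateP oOm bOm cw1 w1Om nq solvable ubar. Qed.

Let WS u : W10 Om q (S u).
Proof. by have [] := control_to_stateP oOm bOm cw1 w1Om nq solvable u. Qed.

(* Along the segment from [ubar] to [u] the transport cost is convex, and the
   reduced functional [J \o S] has a one-sided derivative. *)
Lemma local_optimality_variation u pi : concentrated w1 u ->
  transport_plan w0 w1 u0 u pi ->
  (exists2 e : R, 0 < e & forall u, concentrated w1 u ->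
    (Defs.total_variation (cadd u (copp ubar)) < e%:E)%E ->
    (objective Om w0 w1 u0 c alpha q J ubar <=
     objective Om w0 w1 u0 c alpha q J u)%E) ->
  ((fine (D ubar) - alpha^-1 * DJ ybar (S u - ybar))%:E <=
   \int[pi]_(z in w0 `*` w1) (c z)%:E)%E.
Proof.
move=> cu tpi [e e0 opt].
have [K K0 HK] := total_variation_cscale_le w1 (cadd u (copp ubar)).
have := plan_cost_fin_num cw0 cw1 cc pi.
case EC : (\int[pi]_(z in w0 `*` w1) (c z)%:E)%E => [C| |]// _; rewrite lee_fin.
have [Db EDb] : exists Db, D ubar = Db%:E by case: (D ubar) Dfin => // r _; exists r.
rewrite EDb /=.
have Wh : W10 Om q (S u - ybar) := W10B oOm bOm q1 (WS u) Wybar.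
suff H : - (alpha * (C - Db)) <= DJ ybar (S u - ybar).
  rewrite -(ler_pM2l alpha0) mulrBr mulrA divff ?gt_eqF// mul1r.
  by move: H; rewrite mulrBr; lra.
(* The bound 1 makes the segment a convex combination; the other keeps it in the neighbourhood of
   local optimality, with [+ 1] for K = 0. *)
apply: (@gateaux_ge _ _ _ (Num.min 1 (e / (K + 1)))) => //.
  by rewrite lt_min ltr01 divr_gt0// ltr_wpDl.
move=> t /andP[t0]; rewrite lt_min => /andP[t1 tK].
have t0' : 0 <= t by exact: ltW.
have t1' : 0 <= 1 - t by rewrite subr_ge0 ltW.
pose ut : {charge set 'rV[R]_n.+1 -> \bar R} := cadd ubar (cscale t (cadd u (copp ubar))).
have utE A : ut A = (ubar A + t%:E * (u A - ubar A))%E by [].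
have cut : concentrated w1 ut.
  by move=> A mA Aw1; rewrite utE cubar// cu// sube0 mule0 adde0.
have tv : (Defs.total_variation (cadd ut (copp ubar)) < e%:E)%E.
  apply: (@le_lt_trans _ _ (t * K)%:E).
    apply: HK => // A mA.
    rewrite -[LHS]/(ut A - ubar A)%E utE -[RHS]/(t%:E * (u A - ubar A))%E.
    by rewrite addeC addeA [(- _ + _)%E]addeC subee ?add0e// fin_num_measure.
  rewrite lte_fin; move: tK; rewrite ltr_pdivlMr//; nra.
have := opt ut cut tv; rewrite /objective.
rewrite (@control_to_state_affine _ _ Om w1 q oOm bOm cw1 w1Om q1 nq solvable J
  ubar u ut t cJ); last first.
  move=> f bf; rewrite charge_integral_cadd// charge_integral_cscale//.
  by rewrite charge_integral_cadd// charge_integral_copp.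
set Jt := J (ybar + _) => Hopt.
have key : J ybar + alpha * Db <= Jt + alpha * ((1 - t) * Db + t * C).
  (* An optimal plan for ubar is not at hand, so one with excess below eta / alpha is combined with
     pi; its weight alpha (1 - t) turns the excess into at most eta. *)
  apply/ler_addgt0Pr => eta eta0.
  have ea : 0 < eta / alpha by rewrite divr_gt0.
  have [_ [pi' tpi' <-] Hpi'] := lb_ereal_inf_adherent ea Dfin.
  have {}Hpi' : (\int[pi']_(z in w0 `*` w1) (c z)%:E < D ubar + (eta / alpha)%:E)%E.
    exact: Hpi'.
  move: Hpi' (plan_cost_fin_num cw0 cw1 cc pi'); rewrite EDb.
  case EC' : (\int[pi']_(z in w0 `*` w1) (c z)%:E)%E => [C'| |]// + _.
  rewrite -EFinD lte_fin => C'eta.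
  have := @transport_cost_combination_le _ _ _ _ _ cw0 cw1 u0 _ cc
    (NngNum t1') (NngNum t0') ubar u ut pi' pi.
  rewrite /= subrK => /(_ erefl) Hc.
  have {Hc} : (D ut <= (1 - t)%:E * C'%:E + t%:E * C%:E)%E.
    rewrite -EC' -EC; apply: Hc => // A mA; rewrite utE.
    have fu : u A \is a fin_num by exact: fin_num_measure.
    have fubar : ubar A \is a fin_num by exact: fin_num_measure.
    move: fu fubar.
    case: (u A) => // a _; case: (ubar A) => // b _.
    by rewrite -!EFinN -!EFinD; congr EFin; ring.
  move=> Hc.
  have : ((J ybar)%:E + alpha%:E * D ubar <=
      Jt%:E + alpha%:E * ((1 - t)%:E * C'%:E + t%:E * C%:E))%E.
    apply: le_trans Hopt _; rewrite leeD2l//.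
    by apply: lee_wpmul2l => //; rewrite lee_fin ltW.
  rewrite EDb -!EFinM -!EFinD lee_fin => Hf.
  move: C'eta; rewrite -ltrBlDl ltr_pdivlMr// => C'eta.
  have : (1 - t) * ((C' - Db) * alpha) <= eta by nra.
  nra.
by rewrite ler_pdivlMl//; move: key; nra.
Qed.

Lemma charge_integral_scaled_embedding p u : W10 Om s p -> poisson Om s (DJ ybar) p ->
  charge_integral (cadd u (copp ubar)) w1 (fun xi => - alpha^-1 * E p xi) =
  - alpha^-1 * DJ ybar (S u - ybar).
Proof.
move=> Wp Pp.
have bEp := sobolev_embedding_bounded_measurable oOm bOm cw1 w1Om nq Wp.
rewrite (adjoint_state_identity oOm bOm cw1 w1Om q1 nq solvable ubar u Wp Pp).
(* The multiple b f is read as (b - 1) f + f. *)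
have := charge_integral_lin mw1 (cadd u (copp ubar)) (- alpha^-1 - 1) bEp bEp.
rewrite mulrBl mul1r subrK => <-; apply: eq_charge_integral => x _.
by rewrite mulrBl mul1r subrK.
Qed.

(** The hypothesis is needed plan by plan only: for a control without plans the infimum is +oo and
    there is nothing to prove. *)
Lemma variation_subdifferential p : W10 Om s p -> poisson Om s (DJ ybar) p ->
  (forall u pi, concentrated w1 u -> transport_plan w0 w1 u0 u pi ->
    ((fine (D ubar) - alpha^-1 * DJ ybar (S u - ybar))%:E <=
     \int[pi]_(z in w0 `*` w1) (c z)%:E)%E) ->
  transport_optimality Om w0 w1 u0 c alpha ubar p.
Proof.
move=> Wp Pp H; exists (fun xi => - alpha^-1 * E p xi); last first.
  by move=> xi _; rewrite mulNr mulrN mulrA divff ?gt_eqF// mul1r subrr.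
have cEp := sobolev_embedding_within_continuous oOm bOm w1Om nq Wp.
split.
  move=> x; apply: (@continuousM _ (subspace w1) (cst (- alpha^-1)) (E p)).
    exact: cst_continuous.
  exact: cEp.
move=> u cu; apply: le_ereal_inf_tmp => _ [pi tpi <-].
apply: le_trans (H u pi cu tpi).
rewrite charge_integral_scaled_embedding//.
by rewrite mulNr EFinB fineK.
Qed.

(** Since alpha is nonzero, the subgradient is determined on w1, and the subdifferential sees only
    the values there. *)
Lemma transport_optimalityE p :
  transport_optimality Om w0 w1 u0 c alpha ubar p <->
  transport_subdifferential w0 w1 u0 c ubar (fun xi => - alpha^-1 * E p xi).
Proof.
split=> [[psi sub H]|sub].
  apply: eq_transport_subdifferential sub => xi; rewrite inE => w1xi.
  have := H xi w1xi => /eqP; rewrite eq_sym addrC addr_eq0 => /eqP E1.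
  apply: (mulfI (lt0r_neq0 alpha0)).
  by rewrite E1 mulNr mulrN mulrA divff ?gt_eqF// mul1r.
exists (fun xi => - alpha^-1 * E p xi) => // xi _.
by rewrite mulNr mulrN mulrA divff ?gt_eqF// mul1r subrr.
Qed.

Lemma adjoint_state_exists : poisson_uniquely_solvable Om s ->
  exists2 p, W10 Om s p & poisson Om s (DJ ybar) p.
Proof.
move=> solv; have [dual _] := dJ Wybar; have [_ _ ss _] := conj_expP q1.
have WDJ : Wm1 Om s (DJ ybar) by rewrite /Wm1 ss.
by have [] := solv _ WDJ.
Qed.

Lemma convex_sufficiency p u : convex_on_W10 Om q J ->
  W10 Om s p -> poisson Om s (DJ ybar) p ->
  transport_optimality Om w0 w1 u0 c alpha ubar p -> concentrated w1 u ->
  (objective Om w0 w1 u0 c alpha q J ubar <= objective Om w0 w1 u0 c alpha q J u)%E.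
Proof.
move=> convJ Wp Pp /transport_optimalityE sub cu.
have [_ /(_ u cu)] := sub; rewrite charge_integral_scaled_embedding//.
(* Convexity bounds every difference quotient with t < 1 by this difference. *)
have conv : DJ ybar (S u - ybar) <= J (S u) - J ybar.
  apply: (gateaux_le Wybar (W10B oOm bOm q1 (WS u) Wybar) ltr01) => t /andP[t0 t1].
  have t01 : 0 <= t <= 1 by rewrite !ltW.
  have := convJ (S u) ybar t (WS u) Wybar t01.
  have -> : t *: S u + (1 - t) *: ybar = ybar + t *: (S u - ybar).
    by rewrite scalerBl scale1r scalerBr addrC addrA addrAC.
  by move=> H; rewrite ler_pdivrMl//; move: H; nra.
rewrite /objective; case: (D ubar) Dfin => // Db _.
case: (D u) => [Du| |]//.
  rewrite -!EFinM -!EFinD !lee_fin => H.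
  have : alpha * (Db + - alpha^-1 * DJ ybar (S u - ybar)) <= alpha * Du.
    by rewrite ler_pM2l.
  rewrite mulrDr mulNr mulrN mulrA divff ?gt_eqF// mul1r; lra.
by move=> _; rewrite gt0_muley ?lte_fin// addey// leey.
Qed.

End at_control.

End optimality.

Theorem theorem4p2 (R : realType) (d0 d1 : nat)
    (Hd1 : d1 = 2%N \/ d1 = 3%N)
    (Om : set 'rV[R]_d1) (HOm : bounded_lipschitz_domain Om)
    (w0 : set 'rV[R]_d0) (w1 : set 'rV[R]_d1)
    (Hw0 : w0 !=set0 /\ compact w0)
    (Hw1 : [/\ w1 !=set0, compact w1 & w1 `<=` closure Om])
    (u0 : {finite_measure set 'rV[R]_d0 -> \bar R}) (Hu0 : concentrated w0 u0)
    (c : 'rV[R]_d0 * 'rV[R]_d1 -> R)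
    (Hc : {within w0 `*` w1, continuous c})
    (alpha : R) (Halpha : 0 < alpha)
    (pOm : R) (HpOm : d1%:R < pOm)
    (Hpoisson : forall r : R, conj_exp pOm < r < pOm ->
       poisson_uniquely_solvable Om r)
    (q : R) (Hq1 : 1 < q) (Hq : d1%:R < conj_exp q < pOm)
    (Hq3 : d1 = 3%N -> conj_exp q < 6)
    (J : @sobolev_fun R d1 -> R) (HJ : continuous_on_W10 Om q J)
    (DJ : @sobolev_fun R d1 -> @sobolev_fun R d1 -> R)
    (HDJ : forall y, W10 Om q y -> is_gateaux_derivative Om q J y (DJ y)) :
  (forall ubar : {charge set 'rV[R]_d1 -> \bar R},
     locally_optimal Om w0 w1 u0 c alpha q J ubar ->
     let ybar := control_to_state Om w1 q ubar in
     (exists p, [/\ W10 Om (conj_exp q) p,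
                    poisson Om (conj_exp q) (DJ ybar) p &
                    transport_optimality Om w0 w1 u0 c alpha ubar p]) /\
     (forall p, W10 Om (conj_exp q) p ->
        let zeta := fun xi => - alpha^-1 * sobolev_embedding Om p xi in
        transport_optimality Om w0 w1 u0 c alpha ubar p <->
        dual_solution w0 w1 u0 c ubar (c_conjugate w1 c zeta) zeta)) /\
  (convex_on_W10 Om q J ->
   forall ubar : {charge set 'rV[R]_d1 -> \bar R},
     concentrated w1 ubar -> (transport_cost w0 w1 u0 c ubar < +oo)%E ->
     let ybar := control_to_state Om w1 q ubar in
     (exists p, [/\ W10 Om (conj_exp q) p,
                    poisson Om (conj_exp q) (DJ ybar) p &
                    transport_optimality Om w0 w1 u0 c alpha ubar p]) ->
     globally_optimal Om w0 w1 u0 c alpha q J ubar).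
Proof.
(* Morrey's argument singles out one coordinate, hence the dimension [n.+1]. *)
destruct d1 as [|n]; first by case: Hd1.
have [_ oOm _ bOm _] := HOm; have [_ cw0] := Hw0; have [w10 cw1 w1Om] := Hw1.
have /andP[nq qp] := Hq.
have n2 : 2 <= n.+1%:R :> R by case: Hd1 => -[->]; rewrite ler_nat.
have q10 : 0 < q - 1 by rewrite subr_gt0.
have p2 : 2 < pOm by exact: le_lt_trans HpOm.
have p10 : 0 < pOm - 1 by lra.
have qE : conj_exp q * (q - 1) = q by rewrite /conj_exp divfK ?gt_eqF.
(* The exponents satisfy pOm' < q < 2 < q' < pOm: the bound q' < pOm dualizes to pOm' < q, and
   dimension at least 2 puts 2 between q and q'. So [Hpoisson] covers both the state and the adjoint
   equation. *)
have pq : conj_exp pOm < q.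
  by rewrite ltr_pdivrMr//; move: qp; rewrite -(ltr_pM2r q10) qE; nra.
have pp2 : conj_exp pOm < 2 by rewrite ltr_pdivrMr//; lra.
have q2 : q < 2 by move: nq; rewrite -(ltr_pM2r q10) qE; nra.
have solv : poisson_uniquely_solvable Om q.
  by apply: Hpoisson; rewrite pq (lt_trans q2).
have solv' : poisson_uniquely_solvable Om (conj_exp q).
  by apply: Hpoisson; rewrite qp andbT (lt_trans pp2)// (le_lt_trans n2).
split=> [ubar [cubar fubar opt] ybar|convJ ubar cubar dubar ybar [p [Wp Pp top]]].
  have dubar : (transport_cost w0 w1 u0 c ubar < +oo)%E.
    move: fubar; rewrite /objective.
    case: (transport_cost w0 w1 u0 c ubar) => [r _| |]//; first by rewrite ltry.
    by rewrite gt0_muley ?lte_fin// addey.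
  have vari p (Wp : W10 Om (conj_exp q) p) (Pp : poisson Om (conj_exp q) (DJ ybar) p) :
      transport_optimality Om w0 w1 u0 c alpha ubar p.
    apply: (variation_subdifferential oOm bOm cw0 cw1 w10 w1Om Hq1 nq solv Hc Halpha dubar Wp Pp).
    move=> u pi cu tpi.
    exact: (local_optimality_variation oOm bOm cw0 cw1 w10 w1Om Hq1 nq solv Hc Halpha HJ HDJ cubar dubar cu tpi opt).
  have [p0 Wp0 Pp0] := adjoint_state_exists oOm bOm cw1 w1Om Hq1 nq solv HDJ ubar solv'.
  (* This also provides the subgradient needed in the equivalence, where p is an arbitrary element
     of W^{1,q'}_0. *)
  have top0 := vari p0 Wp0 Pp0.
  split; first by exists p0.
  move=> p Wp zeta; split.
    move=> /(transport_optimalityE Om w1 w0 u0 c Halpha ubar) sub.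
    exact: subdifferential_dual_solution.
  move=> sol; apply/(transport_optimalityE Om w1 w0 u0 c Halpha ubar).
  move: top0 => /(transport_optimalityE Om w1 w0 u0 c Halpha ubar) sub0.
  apply: (dual_solution_subdifferential cw0 cw1 w10 Hu0 Hc cubar dubar sub0 _ sol).
  have cEp := sobolev_embedding_within_continuous oOm bOm w1Om nq Wp.
  move=> x; apply: (@continuousM _ (subspace w1) (cst (- alpha^-1)) (sobolev_embedding Om p)).
    exact: cst_continuous.
  exact: cEp.
split => //.
  have := transport_cost_fin_num cw0 cw1 w10 Hc dubar.
  by rewrite /objective; case: (transport_cost w0 w1 u0 c ubar) => // r _;
    rewrite -EFinM -EFinD ltry.
move=> u cu.
exact: (convex_sufficiency oOm bOm cw0 cw1 w10 w1Om Hq1 nq solv Hc Halpha HDJ dubar convJ Wp Pp top cu).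
Qed.
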